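(* Let $P$ be a (3+1)-free poset with incomparability graph $G(P)$, and let $k\ge1$. Then $X_{G(P)}(x_1,\ldots,x_k)$ is SNP, and its Newton polytope is $\mathcal{P}^{(k)}_{\lambda^{\mathrm{gr}}(P)}$. In particular, $\lambda^{\mathrm{gr}}(P)$ dominates the weight of any proper coloring of $G(P)$.
   Context: All graphs and posets are finite. A coloring $f$ of the vertices of $G$ is proper if adjacent vertices receive different colors. $X_G(x_1,\ldots,x_k)=\sum_f \prod_{v\in V(G)}x_{f(v)}$, summed over all proper colorings $f:V(G)\to[k]=\{1,\dots,k\}$. The weight of a coloring $f$ with values in $\{1,2,\ldots\}$ is $\mathrm{wt}(f)=(|f^{-1}(1)|,|f^{-1}(2)|,\ldots)$. For sequences of nonnegative integers of the same total sum, $\beta$ dominates $\gamma$ ($\gamma\preceq\beta$) if $\sum_{i=1}^m\gamma_i\le\sum_{i=1}^m\beta_i$ for all $m$. For $p=\sum_\alpha c_\alpha \mathbf{x}^\alpha\in\mathbb{R}[x_1,\ldots,x_k]$, $\mathrm{supp}(p)=\{\alpha: c_\alpha\ne0\}$ and $\mathrm{Newton}(p)=\mathrm{conv}(\mathrm{supp}(p))$. $p$ is SNP if $\mathrm{supp}(p)=\mathrm{Newton}(p)\cap\mathbb{Z}^k$. For a partition $\lambda$ with exactly $\ell$ positive parts, if $k\ge \ell$ then $\mathcal{P}^{(k)}_\lambda$ is the convex hull in $\mathbb{R}^k$ of all permutations of $(\lambda_1,\ldots,\lambda_\ell,0,\ldots,0)$; if $k<\ell$ then $\mathcal{P}^{(k)}_\lambda=\emptyset$.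 A poset is (3+1)-free if there are no chain $a_1<a_2<a_3$ and element $b$ incomparable to $a_1,a_2,a_3$. The incomparability graph $G(P)$ has the elements of $P$ as vertices and edges joining incomparable pairs. A Dyck path $d$ of length $n$ is a lattice path from $(0,0)$ to $(n,n)$ with steps $\mathsf{n}=(0,1)$ and $\mathsf{e}=(1,0)$ not going below $y=x$. Its Hessenberg function is: $h_d(i)$ is the number of $\mathsf n$ steps preceding the $i$-th $\mathsf e$ step. The indifference graph $G(d)$ has vertex set $[n]$ with an edge between $i<j$ iff $j\le h_d(i)$. The greedy coloring $\mathrm{gr}$ of $G(d)$ processes vertices in the order $1,2,\ldots,n$ and gives each vertex the smallest positive integer not used on its already colored neighbors; $\lambda^{\mathrm{gr}}(d)=\mathrm{wt}(\mathrm{gr})$ (it is a partition of $n$). Definition of $\lambda^{\mathrm{gr}}(P)$. A part listing is a finite word in the letters $v_i$ ($i\ge0$; a single vertex at level $i$) and $b_{i,i+1}(H)$ ($i\ge0$; $H$ a bicolored graph, i.e. a bipartite graph with a given ordered bipartition, whose lower color class is placed at level $i$ and upper color class at level $i+1$). Its associated poset is on the set of all vertices of all the parts, with $x<y$ iff one of the following holds: (i) $x,y$ are at levels $i,j$ with $j-i\ge2$; (ii) $x$ is exactly one level below $y$ and the part containing $x$ appears strictly before the part containing $y$ in the word; (iii) $x$ is exactly one level below $y$ and they are joined by an edge of a bicolored graph $H$ of the listing. It is known that every (3+1)-free poset is isomorphic to the poset of some part listing, and that the poset of a part listing with no letters $b_{i,i+1}(H)$ has incomparability graph isomorphic to $G(d)$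 for some Dyck path $d$. Given a (3+1)-free poset $P$, take a part listing $L$ for $P$. For each part $b_{i,i+1}(H)$ of $L$, with $r$ lower and $s$ upper vertices, let $q_j$ be the probability that $H$ and a uniformly random matching with $\min(r,s)$ edges between lower and upper vertices have exactly $j$ edges in common, let $j$ be the largest index with $q_j\ne0$, and replace the part by the word $v_{i+1}^{s-j}v_i^rv_{i+1}^j$ if $r\ge s$, and by $v_i^jv_{i+1}^sv_i^{r-j}$ if $r<s$. The resulting listing has only letters $v_i$; the incomparability graph of its poset is isomorphic to $G(d)$ for a Dyck path $d$, and $\lambda^{\mathrm{gr}}(P):=\lambda^{\mathrm{gr}}(d)$. The statement is asserted for any such choice of $L$ and $d$. *)

(* Defs.v *)
From HB Require Import structures.
From mathcomp Require Import all_boot all_order all_fingroup all_algebra.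
From mathcomp Require Import classical_sets reals.
From mathcomp Require Import mpoly.

Set Implicit Arguments.
Unset Strict Implicit.
Unset Printing Implicit Defensive.

Import Order.TTheory GRing.Theory Num.Theory.

(* Colors, vertices of [n], and entries of integer sequences are all counted
   from 0: the natural number c stands for the color c + 1, and i : 'I_n for
   the vertex i + 1. *)

Definition proper_coloring (T : finType) (C : eqType) (e : rel T) (f : T -> C) : bool :=
  [forall x, forall y, e x y ==> (f x != f y)].

Definition graph_iso (T U : finType) (e : rel T) (g : rel U) : Prop :=
  exists2 phi : T -> U, bijective phi & forall x y, g (phi x) (phi y) = e x y.

(* Integer sequences with finitely many nonzero terms are represented by lists,
   implicitly extended by zeros; wt stops at the largest color in use. *)
Definition wt (T : finType) (f : T -> nat) : seq nat :=
  mkseq (fun c => #|[set v | f v == c]|) (\max_v (f v).+1).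

Definition dominates (beta gamma : seq nat) : Prop :=
  sumn gamma = sumn beta /\
  forall m, (sumn (take m gamma) <= sumn (take m beta))%N.

Section Newton.
Local Open Scope ring_scope.
Local Open Scope classical_set_scope.

Definition chromatic_poly (R : realType) (T : finType) (e : rel T) (k : nat) :
    {mpoly R[k]} :=
  \sum_(f : {ffun T -> 'I_k} | proper_coloring e f) \prod_(v : T) 'X_(f v).

Variables (R : realType) (k : nat).

Definition convex_hull (S : set 'rV[R]_k) : set 'rV[R]_k :=
  [set x | exists n (a : 'I_n -> R) (p : 'I_n -> 'rV[R]_k),
     [/\ forall i, 0 <= a i, \sum_i a i = 1, forall i, S (p i)
       & x = \sum_i a i *: p i]].

Definition supp (p : {mpoly R[k]}) : set 'rV[R]_k :=
  [set x | exists2 m : 'X_{1..k}, p@_m != 0 & x = \row_i (m i)%:R].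

Definition Newton (p : {mpoly R[k]}) : set 'rV[R]_k := convex_hull (supp p).

Definition SNP (p : {mpoly R[k]}) : Prop :=
  supp p = Newton p `&` [set x | x \is a mxOver Num.int].

Definition permutahedron (lam : seq nat) : set 'rV[R]_k :=
  if (count (fun a => 0 < a)%N lam <= k)%N
  then convex_hull [set x | exists s : 'S_k, x = \row_i (nth 0%N lam (s i))%:R]
  else set0.

End Newton.

Arguments permutahedron R k lam : clear implicits.

Section Posets.
Local Open Scope order_scope.

Definition incomp (disp : Order.disp_t) (P : finPOrderType disp) : rel P :=
  fun x y => x >< y.

Definition three_plus_one_free (disp : Order.disp_t) (P : finPOrderType disp) :
    Prop :=
  ~ exists a1 a2 a3 b : P,
      [/\ a1 < a2, a2 < a3, b >< a1, b >< a2 & b >< a3].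

Definition poset_iso (disp disp' : Order.disp_t) (P : finPOrderType disp)
    (Q : finPOrderType disp') : Prop :=
  exists2 phi : P -> Q, bijective phi & forall x y, (phi x <= phi y) = (x <= y).

End Posets.

(* A Dyck path is the list of its steps. *)
Notation north := true (only parsing).
Notation east := false (only parsing).

Definition is_dyck (n : nat) (d : seq bool) : Prop :=
  [/\ count_mem north d = n, count_mem east d = n
    & forall m, count_mem east (take m d) <= count_mem north (take m d)].

Definition hess (d : seq bool) (i : nat) : nat :=
  let east_steps := [seq p <- iota 0 (size d) | nth north d p == east] in
  count_mem north (take (nth 0 east_steps i) d).

Definition indiff (d : seq bool) : rel nat := fun i j =>
  (i < j) && (j < hess d i) || (j < i) && (i < hess d j).

Definition indiff_graph (n : nat) (d : seq bool) : rel 'I_n :=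
  fun i j => indiff d i j.

(* Smallest natural number not in s. *)
Definition mex (s : seq nat) : nat :=
  find (fun c => c \notin s) (iota 0 (size s).+1).

(* The colors given by the greedy coloring to the vertices 0, ..., m - 1. *)
Fixpoint greedy (e : rel nat) (m : nat) : seq nat :=
  if m is m'.+1 then
    let c := greedy e m' in
    rcons c (mex [seq nth 0 c i | i <- iota 0 m' & e i m'])
  else [::].

Definition lambda_gr_dyck (n : nat) (d : seq bool) : seq nat :=
  wt (fun v : 'I_n => nth 0 (greedy (indiff d) n) v).

(* The letters v_i and b_{i,i+1}(H); H has lower color class 'I_r, upper color
   class 'I_s, and is given by its set of edges. *)
Inductive letter : Type :=
  | vletter (i : nat)
  | bletter (i r s : nat) (H : {set 'I_r * 'I_s}).

Definition letter_vertex (l : letter) : finType :=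
  match l with
  | vletter _ => unit
  | @bletter _ r s _ => ('I_r + 'I_s)%type
  end.

Definition letter_level (l : letter) : letter_vertex l -> nat :=
  match l with
  | vletter i => fun _ => i
  | @bletter i _ _ _ => fun x => if x is inl _ then i else i.+1
  end.

(* Edges are oriented from the lower to the upper color class. *)
Definition letter_edge (l : letter) : rel (letter_vertex l) :=
  match l with
  | vletter _ => fun _ _ => false
  | @bletter _ _ _ H => fun x y =>
      match x, y with inl a, inr b => (a, b) \in H | _, _ => false end
  end.

Definition listing_poset (L : seq letter) : Type :=
  {p : 'I_(size L) & letter_vertex (tnth (in_tuple L) p)}.

Section ListingPoset.
Variable L : seq letter.
Implicit Types x y z : listing_poset L.

HB.instance Definition _ := Finite.on (listing_poset L).

Definition level x : nat := letter_level (tagged x).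

Definition listing_lt : rel (listing_poset L) := fun x y =>
  [|| level x + 2 <= level y,
      (level y == (level x).+1) && (tag x < tag y)
    | [&& level y == (level x).+1, tag x == tag y
        & letter_edge (tagged x) (tagged_as x y)]].

Lemma listing_lt_level x y : listing_lt x y -> level x < level y.
Proof.
by case/or3P => [|/andP[/eqP-> _]|/and3P[/eqP-> _ _]] //; apply/leq_trans;
  rewrite addn2.
Qed.

Lemma listing_lt_irr : irreflexive listing_lt.
Proof. by move=> x; apply/negP => /listing_lt_level; rewrite ltnn. Qed.

Lemma listing_lt_trans : transitive listing_lt.
Proof.
move=> y x z /listing_lt_level xy /listing_lt_level yz.
by apply/or3P/Or31; rewrite addn2 (leq_ltn_trans xy).
Qed.

Fact listing_display : Order.disp_t. Proof. exact: Order.Disp tt tt. Qed.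

HB.instance Definition _ :=
  Order.Lt_isPOrder.Build listing_display (listing_poset L)
    listing_lt_irr listing_lt_trans.

End ListingPoset.

Section Reduction.
Variables r s : nat.
Implicit Types M H : {set 'I_r * 'I_s}.

Definition matching M : bool :=
  [forall u, forall w, [&& u \in M, w \in M & u != w] ==>
     (u.1 != w.1) && (u.2 != w.2)].

Definition full_matchings : {set {set 'I_r * 'I_s}} :=
  [set M | matching M & #|M| == minn r s].

Definition q H (j : nat) : rat :=
  (#|[set M in full_matchings | #|M :&: H| == j]|%:R
   / #|full_matchings|%:R)%R.

Definition max_overlap H : nat :=
  \max_(j < (minn r s).+1 | q H j != 0%R) j.

End Reduction.

Definition reduce_letter (l : letter) : seq letter :=
  match l with
  | vletter i => [:: vletter i]
  | @bletter i r s H =>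
      let j := max_overlap H in
      if s <= r then
        nseq (s - j) (vletter i.+1) ++ nseq r (vletter i)
          ++ nseq j (vletter i.+1)
      else
        nseq j (vletter i) ++ nseq s (vletter i.+1)
          ++ nseq (r - j) (vletter i)
  end.

Definition reduce_listing (L : seq letter) : seq letter :=
  flatten (map reduce_letter L).

(* lam is a value of lambda^gr(P), for some choice of a part listing L of P and
   of a Dyck path d. *)
Definition is_lambda_gr (disp : Order.disp_t) (P : finPOrderType disp)
    (lam : seq nat) : Prop :=
  exists (L : seq letter) (n : nat) (d : seq bool),
    [/\ poset_iso P (listing_poset L),
        is_dyck n d,
        graph_iso (@incomp _ (listing_poset (reduce_listing L)))
                  (@indiff_graph n d)
      & lam = lambda_gr_dyck n d].

(* Main.v *)
(* A color class of the incomparability graph is a chain, so it meets a bicolored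
   part H in at most one lower and one upper vertex, joined by an edge of H if it
   meets it in both.  Vertices of H on the same level look alike from outside H, so
   a coloring with prescribed color sets A below and B above exists iff H has a
   matching of size |A cap B|: only the maximum matching size of H matters.  It
   equals the largest j with q_j <> 0, and the replacement word of v's has the same
   one.  Hence the color class size vectors of G(P) are those of G(d).

   In G(d) the earlier neighbors of a vertex form a clique that is an interval
   ending just before it.  Comparing counts on initial segments, the first m greedy
   color classes contain at least as many vertices as any m color classes.
   Moreover, if class a is larger than class b, exchanging the two colors beyond
   a suitable cut moves one vertex from a to b.

   Such moves turn lambda^gr into every integer vector it dominates, so the support
   consists of all of these.  Each move is also a convex combination of a vector
   and its image under a transposition, which keeps it inside the permutahedron;
   conversely the inequalities defining dominance pass to convex combinations. *)
Require Import Defs.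
From HB Require Import structures.
From mathcomp Require Import classical_sets reals mpoly zify.
From mathcomp Require Import all_boot all_order all_fingroup all_algebra ring.

Set Implicit Arguments.
Unset Strict Implicit.
Unset Printing Implicit Defensive.

Import Order.TTheory GRing.Theory Num.Theory.

(** * Colorings of part listings *)

(** [N] is defined on all natural colors, so graphs with different vertex types can be compared
    through the functions they realize, with no bound on the colors. *)
Definition realizes (T : finType) (e : rel T) (N : nat -> nat) : Prop :=
  exists2 f : T -> nat, proper_coloring e f
    & forall c, #|[set v | f v == c]| = N c.

Lemma proper_coloringP (T : finType) (C : eqType) (e : rel T) (f : T -> C) :
  reflect (forall x y, e x y -> f x != f y) (proper_coloring e f).
Proof.
apply: (iffP forallP) => [H x y exy | H x].
  by have /forallP/(_ y)/implyP := H x; exact.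
by apply/forallP => y; apply/implyP/H.
Qed.

Lemma graph_iso_sym (T U : finType) (e : rel T) (g : rel U) :
  graph_iso e g -> graph_iso g e.
Proof.
case=> phi [psi phiK psiK] phiE; exists psi; first by exists phi.
by move=> x y; rewrite -phiE !psiK.
Qed.

Lemma realizes_pullback (T U : finType) (e : rel T) (g : rel U) N :
  graph_iso e g -> realizes g N -> realizes e N.
Proof.
case=> phi phi_bij phiE [f /proper_coloringP f_proper f_card].
exists (f \o phi) => [|c].
  by apply/proper_coloringP => x y /=; rewrite -phiE => /f_proper.
rewrite -f_card -[RHS](@on_card_preimset _ _ phi); last exact: onW_bij.
by apply: eq_card => x; rewrite !inE.
Qed.

Lemma realizes_iso (T U : finType) (e : rel T) (g : rel U) N :
  graph_iso e g -> realizes e N <-> realizes g N.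
Proof.
by move=> eg; split; apply: realizes_pullback => //; apply: graph_iso_sym.
Qed.

(* In a word of (level, color) pairs, x occurring before y: the vertices are
   incomparable iff they share a level or x sits one level above y. *)
Definition compatible : rel (nat * nat) := fun x y =>
  (x.1 == y.1) || (x.1 == y.1.+1) ==> (x.2 != y.2).

(** Incomparability inside one part, oriented: a pair on two levels is tested only with its lower
    vertex first. *)
Definition letter_proper (l : letter) (g : letter_vertex l -> nat) : Prop :=
  forall x y, x != y ->
    (letter_level x == letter_level y)
    || (letter_level y == (letter_level x).+1) && ~~ letter_edge x y ->
    g x != g y.

Definition letter_word (l : letter) (g : letter_vertex l -> nat) :
    seq (nat * nat) :=
  [seq (letter_level x, g x) | x <- enum (letter_vertex l)].

(** The word is taken up to permutation, because the listing does not order the vertices of a single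
    part. *)
Definition letter_colored (l : letter) (u : seq (nat * nat)) : Prop :=
  exists2 g : letter_vertex l -> nat, letter_proper g & perm_eq u (letter_word g).

(** Pairs inside a block are controlled by [letter_colored]; pairs in different blocks only by
    [compatible], which ignores the edges of the bicolored graphs. *)
Fixpoint colored (L : seq letter) (u : seq (nat * nat)) : Prop :=
  if L is l :: L' then
    exists u1 u2, [/\ u = u1 ++ u2, letter_colored l u1, colored L' u2
                    & allrel compatible u1 u2]
  else u = [::].

Lemma allrel_sub (S T : eqType) (r : S -> T -> bool) s s' t t' :
  {subset s' <= s} -> {subset t' <= t} -> allrel r s t -> allrel r s' t'.
Proof.
move=> ss tt /allrelP H; apply/allrelP => x y xs yt.
by apply: H; [apply: ss | apply: tt].
Qed.

Lemma colored_cat L1 L2 u :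
  colored (L1 ++ L2) u <->
  exists u1 u2, [/\ u = u1 ++ u2, colored L1 u1, colored L2 u2
                  & allrel compatible u1 u2].
Proof.
elim: L1 u => [|l L1 IH] u /=.
  split=> [uP | [u1 [u2 [-> -> //]]]].
  by exists [::], u; rewrite allrel0l.
split.
  move=> [u1 [u2 [-> u1P /IH[v1 [v2 [-> v1P v2P v12]]]]]].
  rewrite allrel_catr => /andP[u11 u12].
  exists (u1 ++ v1), v2; rewrite catA allrel_catl u12 v12; split=> //.
  by exists u1, v1.
move=> [u1 [u2 [-> [v1 [v2 [-> v1P v2P v12]]] u2P]]].
rewrite allrel_catl => /andP[v1u2 v2u2].
exists v1, (v2 ++ u2); rewrite catA allrel_catr v12 v1u2; split=> //.
by apply/IH; exists v2, u2.
Qed.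

Lemma letter_colored_vletter i u :
  letter_colored (vletter i) u <-> exists c, u = [:: (i, c)].
Proof.
split=> [[g _] | [c ->]]; last first.
  by exists (fun=> c) => [[] []|] //=; rewrite /letter_word enumT unlock.
rewrite /letter_word enumT unlock /= => /(perm_small_eq _) ->//.
by exists (g tt).
Qed.

Lemma colored_vletters ls u :
  colored (map vletter ls) u <-> map fst u = ls /\ pairwise compatible u.
Proof.
elim: ls u => [|i ls IH] u /=.
  by split=> [->|[]]; last case: u.
split.
  move=> [u1 [u2 [-> /letter_colored_vletter[c ->] /IH[<- u2P]]]].
  by rewrite allrel1l => H; split=> //=; rewrite u2P andbT.
case: u => [|[j c] u] [] //= -[-> uls] /andP[Hc Hu].
exists [:: (i, c)], u; split; rewrite ?allrel1l //.
  by apply/letter_colored_vletter; exists c.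
by apply/IH.
Qed.

(** * Matchings and the maximal overlap with a bicolored graph *)

Section Matchings.
Variables r s : nat.
Implicit Types M H : {set 'I_r * 'I_s}.

Lemma matchingP M :
  reflect ({in M &, injective fst} /\ {in M &, injective snd}) (matching M).
Proof.
apply: (iffP forallP) => [MP | [M1 M2] u].
  have {}MP u w : u \in M -> w \in M -> u != w -> (u.1 != w.1) && (u.2 != w.2).
    by move=> uM wM uw; have /forallP/(_ w) := MP u; rewrite uM wM uw.
  by split=> u w uM wM E; apply/eqP/negPn/negP => /(MP _ _ uM wM);
    rewrite E eqxx ?andbF.
apply/forallP => w; apply/implyP => /and3P[uM wM uw].
apply/andP; split; apply: contra uw => /eqP E; apply/eqP.
  exact: M1.
exact: M2.
Qed.

Lemma matching_sub M M' : M' \subset M -> matching M -> matching M'.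
Proof.
move=> /subsetP M'M /matchingP[M1 M2]; apply/matchingP.
by split=> u w /M'M uM /M'M wM; [apply: M1 | apply: M2].
Qed.

Lemma matching_leq M : matching M -> #|M| <= minn r s.
Proof.
move=> /matchingP[M1 M2]; rewrite leq_min; apply/andP; split.
  by rewrite -(card_in_imset M1) (leq_trans (max_card _)) ?card_ord.
by rewrite -(card_in_imset M2) (leq_trans (max_card _)) ?card_ord.
Qed.

(** A matching with fewer than [minn r s] edges misses a vertex on each side. These two can be
    joined, since any pair of ['I_r * 'I_s] may serve as an edge. *)
Lemma matching_extend M :
  matching M -> exists2 M', M' \in full_matchings r s & M \subset M'.
Proof.
have [n] := ubnP (minn r s - #|M|); elim: n M => // n IH M Mn Mm.
have := matching_leq Mm; rewrite leq_eqVlt => /orP[/eqP ME | Mlt].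
  by exists M; rewrite // inE Mm ME eqxx.
have /matchingP[M1 M2] := Mm.
have [x xM] : exists x, x \notin fst @: M.
  apply/existsP; rewrite -negb_forall; apply/negP => /forallP H.
  have : #|'I_r| <= #|fst @: M| by apply/subset_leq_card/subsetP => z _; apply: H.
  by rewrite card_ord (card_in_imset M1); lia.
have [y yM] : exists y, y \notin snd @: M.
  apply/existsP; rewrite -negb_forall; apply/negP => /forallP H.
  have : #|'I_s| <= #|snd @: M| by apply/subset_leq_card/subsetP => z _; apply: H.
  by rewrite card_ord (card_in_imset M2); lia.
have xyM : (x, y) \notin M.
  by apply: contra xM => xyM; apply/imsetP; exists (x, y).
have nx w : w \in M -> x != w.1.
  by move=> wM; apply: contraNneq xM => ->; apply/imsetP; exists w.
have ny w : w \in M -> y != w.2.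
  by move=> wM; apply: contraNneq yM => ->; apply/imsetP; exists w.
have [||M' M'P sub] := IH ((x, y) |: M).
- by rewrite cardsU1 xyM; lia.
- apply/matchingP; split=> u w /setU1P[->|uM] /setU1P[->|wM] //= E.
  + by have := nx _ wM; rewrite E eqxx.
  + by have := nx _ uM; rewrite E eqxx.
  + exact: M1.
  + by have := ny _ wM; rewrite E eqxx.
  + by have := ny _ uM; rewrite E eqxx.
  + exact: M2.
by exists M' => //; apply: subset_trans sub; apply: subsetUr.
Qed.

Lemma q_neq0 H j :
  reflect (exists2 M, M \in full_matchings r s & #|M :&: H| = j) (q H j != 0%R).
Proof.
(* If there were no full matching, the denominator of [q] would be zero and [q] would vanish
   identically. *)
have full_gt0 : 0 < #|full_matchings r s|.
  have [|M MP _] := @matching_extend set0; last first.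
    by rewrite card_gt0; apply/set0Pn; exists M.
  by apply/matchingP; split=> u w; rewrite inE.
rewrite /q mulf_eq0 invr_eq0 !Num.Theory.pnatr_eq0 negb_or.
rewrite -!lt0n full_gt0 andbT; apply: (iffP card_gt0P) => [[M]|[M MP MH]].
  by rewrite inE => /andP[MP /eqP MH]; exists M.
by exists M; rewrite inE MP MH eqxx.
Qed.

(** A full matching extending [M] meets [H] in at least [M]. Together with [max_overlap_attained]
    this identifies [max_overlap H] as the largest size of a matching in [H]. *)
Lemma max_overlap_ge H M : matching M -> M \subset H -> #|M| <= max_overlap H.
Proof.
move=> Mm MH; have [M' M'P MM'] := matching_extend Mm.
have M'le : #|M' :&: H| < (minn r s).+1.
  move: M'P; rewrite inE ltnS => /andP[_ /eqP <-].
  by apply/subset_leq_card/subsetIl.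
apply: (@leq_trans #|M' :&: H|).
  by apply/subset_leq_card; rewrite subsetI MM'.
apply: (@leq_bigmax_cond _ (fun j : 'I__ => q H j != 0%R) (fun j => j : nat)
  (Ordinal M'le)).
by apply/q_neq0; exists M'.
Qed.

(** The overlap of a full matching with [H] is itself a matching in [H], and its subsets provide all
    smaller sizes. *)
Lemma max_overlap_attained H t : t <= max_overlap H ->
  exists M, [/\ matching M, M \subset H & #|M| = t].
Proof.
have [M [Mm MH <-]] : exists M, [/\ matching M, M \subset H & #|M| = max_overlap H].
  rewrite /max_overlap; elim/big_ind: _ => [|m n IHm IHn|j].
  - exists set0; rewrite sub0set cards0; split=> //.
    by apply/matchingP; split=> u w; rewrite inE.
  - by rewrite /maxn; case: ifP.
  - move=> /q_neq0[M]; rewrite inE => /andP[Mm _] MH.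
    exists (M :&: H); rewrite subsetIr; split=> //.
    by apply: matching_sub Mm; apply: subsetIl.
move=> tM; exists [set x in take t (enum M)].
have sub : [set x in take t (enum M)] \subset M.
  by apply/subsetP => x; rewrite inE => /mem_take; rewrite mem_enum.
split; first exact: matching_sub Mm.
  exact: subset_trans MH.
rewrite cardsE (card_uniqP _) ?take_uniq ?enum_uniq //.
by rewrite size_takel // -cardE.
Qed.

End Matchings.

Lemma max_overlap_leq r s (H : {set 'I_r * 'I_s}) : max_overlap H <= minn r s.
Proof. by have [M [/matching_leq + _ <-]] := @max_overlap_attained r s H _ (leqnn _). Qed.

(** * Colorings of a single bicolored part *)

Lemma enum_sumE (T U : finType) :
  perm_eq (enum {: (T + U)%type}) (map inl (enum T) ++ map inr (enum U)).
Proof.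
apply: uniq_perm; rewrite ?enum_uniq //.
  have inl_inj : injective (@inl T U) by move=> x y [].
  have inr_inj : injective (@inr T U) by move=> x y [].
  rewrite cat_uniq !map_inj_uniq // -!enumT !enum_uniq andbT.
  by apply/hasPn => _ /mapP[y _ ->]; apply/mapP => -[].
move=> [x|x]; rewrite mem_enum mem_cat; apply/esym/orP; [left|right];
  by apply/mapP; exists x; rewrite ?mem_enum.
Qed.

Lemma map_nth_index (S T : eqType) (x0 : T) (s : seq S) (t : seq T) :
  uniq s -> size s = size t -> [seq nth x0 t (index x s) | x <- s] = t.
Proof.
move=> s_uniq st; case: s => [|y s] in s_uniq st *.
  by case: t st.
apply: (@eq_from_nth _ x0); rewrite size_map // => i i_lt.
by rewrite (nth_map y) // index_uniq.
Qed.

Lemma letter_word_bletter i r s (H : {set 'I_r * 'I_s})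
    (g : letter_vertex (bletter i H) -> nat) :
  perm_eq (letter_word g) ([seq (i, g (inl x)) | x <- enum 'I_r]
                           ++ [seq (i.+1, g (inr y)) | y <- enum 'I_s]).
Proof.
apply: perm_trans (perm_map _ (@enum_sumE _ _)) _.
by rewrite map_cat -!map_comp.
Qed.

(** Each level is an antichain, so its colors are distinct. A color used on both levels joins the
    ends of an edge of [H], so shared colors form a matching in [H]. Conversely, the shared colors
    can be put on the edges of a matching of that size and the other colors placed freely. *)
Lemma letter_colored_bletter i r s (H : {set 'I_r * 'I_s}) u :
  letter_colored (bletter i H) u <->
  exists A B, [/\ uniq A /\ size A = r, uniq B /\ size B = s,
    size [seq a <- A | a \in B] <= max_overlap H
    & perm_eq u (map (pair i) A ++ map (pair i.+1) B)].
Proof.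
split=> [[g gP uP] | [A [B [[Au As] [Bu Bs] AB uP]]]].
- have inl_inj : injective (g \o inl).
    move=> x y /= E; apply/eqP; apply/negPn/negP => xy.
    by have := gP (inl x) (inl y) xy; rewrite /= eqxx E eqxx => /(_ isT).
  have inr_inj : injective (g \o inr).
    move=> x y /= E; apply/eqP; apply/negPn/negP => xy.
    by have := gP (inr x) (inr y) xy; rewrite /= eqxx E eqxx => /(_ isT).
  exists (map (g \o inl) (enum 'I_r)), (map (g \o inr) (enum 'I_s)).
  rewrite !map_inj_uniq // -!enumT !enum_uniq !size_map -?enumT -!cardE !card_ord.
  split=> //; last first.
  rewrite -(map_comp (pair i)) -(map_comp (pair i.+1)).
  by rewrite (perm_trans uP) ?letter_word_bletter.
  (* The pairs with equal colors form a matching in [H] with one edge for each shared color. *)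
  set M := [set p : 'I_r * 'I_s | g (inl p.1) == g (inr p.2)].
  have MP p : p \in M -> g (inl p.1) = g (inr p.2) by rewrite inE => /eqP.
  have Mm : matching M.
    apply/matchingP; split=> -[x y] [x' y'] /MP /= E /MP /= E' xx; rewrite xx.
      by congr pair; apply: inr_inj; rewrite /= -E -E' xx.
    by congr pair; apply: inl_inj; rewrite /= E E' xx.
  have MH : M \subset H.
    apply/subsetP => -[x y] /MP /= E; apply/negPn/negP => xyH.
    by have := gP (inl x) (inr y) isT; rewrite /= eqxx xyH orbT E eqxx => /(_ isT).
  apply: leq_trans (max_overlap_ge Mm MH).
  rewrite cardE -(size_map (fun p => g (inl p.1))).
  apply: uniq_leq_size; first by rewrite filter_uniq // map_inj_uniq // enum_uniq.
  move=> c; rewrite mem_filter => /andP[/mapP[y _ cy] /mapP[x _ cx]].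
  apply/mapP; exists (x, y); last exact: cx.
  rewrite mem_enum inE; apply/eqP; exact: etrans (esym cx) cy.
set C := [seq a <- A | a \in B] in AB.
have [M [Mm MH MC]] := max_overlap_attained AB.
have /matchingP[M1 M2] := Mm.
(* The vertex lists [xs], [ys] start with the ends of the edges of [M], in the same order; the color
   lists [A'], [B'] start with the shared colors [C]. Coloring by position gives both ends of each
   edge the same shared color. *)
pose ms := enum M.
pose xs := map fst ms ++ [seq x <- enum 'I_r | x \notin map fst ms].
pose ys := map snd ms ++ [seq y <- enum 'I_s | y \notin map snd ms].
pose A' := C ++ [seq a <- A | a \notin B].
pose B' := C ++ [seq b <- B | b \notin A].
have part_perm (T : eqType) (p t : seq T) : uniq p -> uniq t -> {subset p <= t} ->
    perm_eq (p ++ [seq x <- t | x \notin p]) t.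
  move=> pu tu pt; apply: uniq_perm => //.
    rewrite cat_uniq pu filter_uniq // andbT.
    by apply/hasPn => x; rewrite mem_filter => /andP[].
  move=> x; rewrite mem_cat mem_filter.
  by case: (boolP (x \in p)) => //= /pt ->.
have xsP : perm_eq xs (enum 'I_r).
  apply: part_perm; rewrite ?enum_uniq //; last by move=> x; rewrite mem_enum.
  rewrite map_inj_in_uniq ?enum_uniq // => p p'; rewrite !mem_enum; exact: M1.
have ysP : perm_eq ys (enum 'I_s).
  apply: part_perm; rewrite ?enum_uniq //; last by move=> x; rewrite mem_enum.
  rewrite map_inj_in_uniq ?enum_uniq // => p p'; rewrite !mem_enum; exact: M2.
have A'P : perm_eq A' A by rewrite /A' (perm_filterC (mem B)).
have B'P : perm_eq B' B.
  rewrite (perm_trans (y := [seq b <- B | b \in A] ++ [seq b <- B | b \notin A])) //.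
    rewrite perm_cat2r; apply: uniq_perm; rewrite ?filter_uniq // => c.
    by rewrite !mem_filter /= andbC.
  by rewrite (perm_filterC (mem A)).
have xs_uniq : uniq xs by rewrite (perm_uniq xsP) enum_uniq.
have ys_uniq : uniq ys by rewrite (perm_uniq ysP) enum_uniq.
have xs_size : size xs = size A'.
  by rewrite (perm_size xsP) (perm_size A'P) -cardE card_ord.
have ys_size : size ys = size B'.
  by rewrite (perm_size ysP) (perm_size B'P) -cardE card_ord.
have A'u : uniq A' by rewrite (perm_uniq A'P).
have B'u : uniq B' by rewrite (perm_uniq B'P).
have in_xs x : index x xs < size A'.
  by rewrite -xs_size index_mem (perm_mem xsP) mem_enum.
have in_ys y : index y ys < size B'.
  by rewrite -ys_size index_mem (perm_mem ysP) mem_enum.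
have in_xs' x : x \in xs by rewrite -index_mem xs_size.
have in_ys' y : y \in ys by rewrite -index_mem ys_size.
pose g (v : letter_vertex (bletter i H)) := match v with
  | inl x => nth 0 A' (index x xs) | inr y => nth 0 B' (index y ys) end.
exists g; last first.
  rewrite (perm_trans uP) // perm_sym (perm_trans (letter_word_bletter _)) //.
  apply: perm_cat.
    rewrite (perm_trans (y := [seq (i, g (inl x)) | x <- xs])) //.
      by rewrite perm_sym perm_map.
    rewrite (map_comp (pair i) (fun x => g (inl x))) perm_map //=.
    by rewrite map_nth_index.
  rewrite (perm_trans (y := [seq (i.+1, g (inr x)) | x <- ys])) //.
    by rewrite perm_sym perm_map.
  rewrite (map_comp (pair i.+1) (fun x => g (inr x))) perm_map //=.
  by rewrite map_nth_index.
have sizeC : size C = size ms by rewrite -MC cardE.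
have C_uniq : uniq C by rewrite filter_uniq.
move=> [x|x] [y|y] /= xy; rewrite ?eqxx ?andbT.
- move=> _; rewrite nth_uniq //; apply: contra xy => /eqP.
  by move=> /index_inj -> //.
- rewrite (ltn_eqF (ltnSn i)) /=.
  (* A color common to [x] and [y] lies in the common prefix [C], at one position in both lists; so
     [x] and [y] are the two ends of one edge of [M]. *)
  apply: contraNneq => E.
  have cC : nth 0 A' (index x xs) \in C.
    rewrite mem_filter -(perm_mem A'P) mem_nth // andbT.
    by rewrite E -(perm_mem B'P) mem_nth.
  have idxA : index x xs = index (nth 0 A' (index x xs)) C.
    by rewrite -{1}(index_uniq 0 (in_xs x) A'u) /A' index_cat -/A' cC.
  have idxB : index y ys = index (nth 0 A' (index x xs)) C.
    by rewrite -{1}(index_uniq 0 (in_ys y) B'u) -E /B' index_cat cC.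
  have lt_ms : index x xs < size ms by rewrite idxA -sizeC index_mem.
  have xE : x = (nth (x, y) ms (index x xs)).1.
    by rewrite -{1}(nth_index x (in_xs' x)) nth_cat size_map lt_ms (nth_map (x, y)).
  have yE : y = (nth (x, y) ms (index x xs)).2.
    have yx : index y ys = index x xs by rewrite idxB -idxA.
    by rewrite -{1}(nth_index y (in_ys' y)) yx nth_cat size_map lt_ms (nth_map (x, y)).
  have -> : (x, y) = nth (x, y) ms (index x xs).
    by rewrite [RHS]surjective_pairing -xE -yE.
  by apply: (subsetP MH); rewrite -mem_enum mem_nth.
- by rewrite (gtn_eqF (ltnSn i)) (ltn_eqF (leqW (ltnSn i))).
- move=> _; rewrite nth_uniq //; apply: contra xy => /eqP.
  by move=> /index_inj -> //.
Qed.

(** * Replacement of bicolored parts by single vertices *)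

Definition reduced_levels (l : letter) : seq nat :=
  match l with
  | vletter i => [:: i]
  | @bletter i r s H =>
      let j := max_overlap H in
      if s <= r then nseq (s - j) i.+1 ++ nseq r i ++ nseq j i.+1
      else nseq j i ++ nseq s i.+1 ++ nseq (r - j) i
  end.

Lemma reduce_letterE l : reduce_letter l = map vletter (reduced_levels l).
Proof.
by case: l => //= i r s H; case: ifP => _; rewrite !map_cat !map_nseq.
Qed.

Lemma map_fst_cat (S T : Type) (u : seq (S * T)) s1 s2 :
  map fst u = s1 ++ s2 ->
  exists u1 u2, [/\ u = u1 ++ u2, map fst u1 = s1 & map fst u2 = s2].
Proof.
move=> E; exists (take (size s1) u), (drop (size s1) u).
by rewrite cat_take_drop map_take map_drop E take_size_cat ?drop_size_cat.
Qed.

Lemma map_fst_nseq (S T : Type) (u : seq (S * T)) n i :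
  map fst u = nseq n i -> exists2 A, u = map (pair i) A & size A = n.
Proof.
elim: u n => [|[j c] u IH] [|n] //= => [_|[-> /IH[A -> <-]]]; first by exists [::].
by exists (c :: A).
Qed.

Lemma pairwise_level i A : pairwise compatible (map (pair i) A) = uniq A.
Proof.
rewrite pairwise_map uniq_pairwise; apply: eq_pairwise => a b.
by rewrite /compatible /= eqxx.
Qed.

Lemma allrel_compatible i j A B : (i == j) || (i == j.+1) ->
  allrel compatible (map (pair i) A) (map (pair j) B) = ~~ has (mem A) B.
Proof.
move=> ij; apply/allrelP/hasPn => [H b bB | H _ _ /mapP[a aA ->] /mapP[b bB ->]].
  apply/negP => bA; have := H (i, b) (j, b) (map_f _ bA) (map_f _ bB).
  by rewrite /compatible /= ij eqxx.
by rewrite /compatible ij /=; apply: contraTneq aA => ->; apply: H.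
Qed.

(** A vertex placed before another that is one level higher lies below it, so the two colors are
    unrestricted. *)
Lemma allrel_compatible_lt i A B :
  allrel compatible (map (pair i) A) (map (pair i.+1) B).
Proof.
apply/allrelP => _ _ /mapP[a aA ->] /mapP[b bB ->]; rewrite /compatible /=.
by rewrite (ltn_eqF (ltnSn i)) (ltn_eqF (leqW (ltnSn i))).
Qed.

Lemma common_colors (A B : seq nat) : uniq A -> uniq B ->
  size [seq a <- A | a \in B] = size [seq b <- B | b \in A].
Proof.
move=> Au Bu; apply: perm_size; apply: uniq_perm; rewrite ?filter_uniq // => c.
by rewrite !mem_filter /= andbC.
Qed.

Lemma map_fst_pair (S T : Type) (i : S) (A : seq T) :
  map fst (map (pair i) A) = nseq (size A) i.
Proof. by elim: A => //= a A ->. Qed.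

(** Both replacement words have this shape, with [i] and [j] consecutive levels in either order. The
    outer blocks share a level and form one antichain, hence [uniq (A1 ++ A3)]. *)
Lemma colored_blocks n1 n2 n3 i j u :
  colored (map vletter (nseq n1 i ++ nseq n2 j ++ nseq n3 i)) u <->
  exists A1 A2 A3, [/\ [/\ size A1 = n1, size A2 = n2 & size A3 = n3],
    u = map (pair i) A1 ++ map (pair j) A2 ++ map (pair i) A3,
    uniq (A1 ++ A3) && uniq A2, allrel compatible (map (pair i) A1) (map (pair j) A2)
    & allrel compatible (map (pair j) A2) (map (pair i) A3)].
Proof.
rewrite colored_vletters; split.
  move=> [/map_fst_cat[u1 [u' [uE u1E /map_fst_cat[u2 [u3 [u'E u2E u3E]]]]]]].
  have [A1 A1E <-] := map_fst_nseq u1E; have [A2 A2E <-] := map_fst_nseq u2E.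
  have [A3 A3E <-] := map_fst_nseq u3E.
  rewrite uE u'E A1E A2E A3E !pairwise_cat !allrel_catr !pairwise_level.
  move=> /and3P[/andP[H1 H2] A1u /and3P[H3 A2u A3u]].
  exists A1, A2, A3; rewrite cat_uniq A1u A2u A3u.
  by rewrite allrel_compatible ?eqxx // in H2; rewrite H2.
move=> [A1 [A2 [A3 [[<- <- <-] -> /andP[]]]]].
rewrite cat_uniq => /and3P[A1u A13 A3u] A2u H1 H2.
rewrite !map_cat !map_fst_pair; split=> //.
rewrite !pairwise_cat !allrel_catr !pairwise_level A1u A2u A3u H1 H2.
by rewrite allrel_compatible ?eqxx // A13.
Qed.

(** At most [j] colors are shared by the two levels, and the replacement word has exactly [j]
    vertices on the split level that are comparable to the other level. The colors only have to be
    arranged so that the shared ones fall there. *)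
Lemma reduce_letter_colored l u :
  letter_colored l u -> exists2 w, perm_eq u w & colored (reduce_letter l) w.
Proof.
case: l => [i|i r s H].
  move=> /letter_colored_vletter[c ->]; exists [:: (i, c)] => //.
  by rewrite reduce_letterE colored_vletters.
case/letter_colored_bletter=> A [B [[Au As] [Bu Bs] AB uP]].
have := max_overlap_leq H; rewrite leq_min reduce_letterE /=.
set j := max_overlap H in AB * => /andP[jr js].
have disjoint_part (X Y : seq nat) n : n <= size [seq x <- X | x \notin Y] ->
    {in take n ([seq x <- X | x \notin Y] ++ [seq x <- X | x \in Y]), forall x, x \notin Y}.
  move=> le_n x; rewrite takel_cat // => /mem_take; by rewrite mem_filter => /andP[].
have split_perm (X Y : seq nat) :
    perm_eq X ([seq x <- X | x \notin Y] ++ [seq x <- X | x \in Y]).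
  by rewrite perm_sym perm_catC (perm_filterC (mem Y)).
case: ifP => [_|/negbT]; last rewrite -ltnNge => rs.
- pose B' := [seq b <- B | b \notin A] ++ [seq b <- B | b \in A].
  have B'P : perm_eq B B' := split_perm B A.
  (* The [s - j] upper vertices placed before the lower ones are incomparable to them, so they take
     colors outside [A]; there are enough, since [B] shares at most [j] colors with [A]. *)
  pose B1 := take (s - j) B'; pose B2 := drop (s - j) B'.
  exists (map (pair i.+1) B1 ++ map (pair i) A ++ map (pair i.+1) B2).
    rewrite (perm_trans uP) // perm_sym perm_catCA perm_cat2l -map_cat.
    by rewrite cat_take_drop perm_map // perm_sym.
  apply/colored_blocks; exists B1, A, B2.
  rewrite cat_take_drop -(perm_uniq B'P) Au Bu size_drop -(perm_size B'P) Bs subKn //.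
  rewrite size_takel -?(perm_size B'P) ?Bs ?leq_subr //; split=> //.
    rewrite allrel_compatible ?eqxx ?orbT //; apply/hasPn => a aA.
    have le_n : s - j <= size [seq b <- B | b \notin A].
      by have := perm_size B'P; rewrite size_cat -(common_colors Au Bu) Bs; lia.
    by apply/negP => /(disjoint_part _ _ _ le_n); rewrite aA.
  exact: allrel_compatible_lt.
- pose A' := [seq a <- A | a \in B] ++ [seq a <- A | a \notin B].
  have A'P : perm_eq A A' by rewrite (perm_trans (split_perm A B)) // perm_catC.
  (* Here the lower vertices placed last are incomparable to the upper ones; the shared colors, at
     most [j] in number, come first in [A'] and all go into [A1]. *)
  pose A1 := take j A'; pose A2 := drop j A'.
  exists (map (pair i) A1 ++ map (pair i.+1) B ++ map (pair i) A2).
    rewrite (perm_trans uP) // perm_sym perm_catCA perm_catC perm_cat2r -map_cat.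
    by rewrite cat_take_drop perm_map // perm_sym.
  apply/colored_blocks; exists A1, B, A2.
  rewrite cat_take_drop -(perm_uniq A'P) Au Bu size_drop -(perm_size A'P) As.
  rewrite size_takel -?(perm_size A'P) ?As //; split=> //.
    exact: allrel_compatible_lt.
  rewrite allrel_compatible ?eqxx ?orbT //; apply/hasPn => a.
  rewrite /A2 drop_cat ltnNge AB /= => /mem_drop.
  by rewrite mem_filter => /andP[].
Qed.

(** The block of the split level that is incomparable to the other level avoids its colors, so all
    shared colors come from the remaining block, of size [j]. *)
Lemma letter_colored_reduce l w :
  colored (reduce_letter l) w -> letter_colored l w.
Proof.
case: l => [i|i r s H].
  by move=> [u1 [u2 [-> u1P -> _]]]; rewrite cats0.
have := max_overlap_leq H; rewrite leq_min reduce_letterE /= => /andP[jr js].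
case: ifP => [_|/negbT]; last rewrite -ltnNge => rs.
- move=> /colored_blocks[B1 [A [B2 [[s1 s2 s3] -> /andP[Bu Au] H1 H2]]]].
  rewrite allrel_compatible ?eqxx ?orbT // in H1.
  apply/letter_colored_bletter; exists A, (B1 ++ B2).
  rewrite size_cat s1 s3 subnK //; split=> //; last first.
    by rewrite perm_catCA perm_cat2l map_cat.
  rewrite (@eq_in_filter _ _ (mem B2)) => [|a aA]; last first.
    rewrite mem_cat; case: (boolP (a \in B1)) => //= aB1.
    by case/hasP: H1; exists a.
  rewrite (common_colors Au) -?s3 ?size_filter ?count_size //.
  by move: Bu; rewrite cat_uniq => /and3P[].
- move=> /colored_blocks[A1 [B [A2 [[s1 s2 s3] -> /andP[Au Bu] H1 H2]]]].
  rewrite allrel_compatible ?eqxx ?orbT // in H2.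
  apply/letter_colored_bletter; exists (A1 ++ A2), B.
  rewrite size_cat s1 s3 subnKC //; split=> //; last first.
    by rewrite map_cat -catA perm_cat2l perm_catC.
  rewrite filter_cat size_cat [X in _ + size X](_ : _ = [::]) ?addn0.
    by rewrite -s1 size_filter count_size.
  apply/eqP; rewrite -[_ == _]negbK -has_filter; exact: H2.
Qed.

Lemma allrel_perm (u v u' v' : seq (nat * nat)) :
  perm_eq u u' -> perm_eq v v' -> allrel compatible u v -> allrel compatible u' v'.
Proof.
move=> uu vv; apply: allrel_sub => x; first by rewrite (perm_mem uu).
by rewrite (perm_mem vv).
Qed.

Lemma reduce_colored L u :
  colored L u -> exists2 w, perm_eq u w & colored (reduce_listing L) w.
Proof.
elim: L u => [|l L IH] u /=; first by move=> ->; exists [::].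
move=> [u1 [u2 [-> /reduce_letter_colored[w1 uw1 w1P] /IH[w2 uw2 w2P] u12]]].
exists (w1 ++ w2); first exact: perm_cat.
by apply/colored_cat; exists w1, w2; rewrite (allrel_perm uw1 uw2).
Qed.

Lemma colored_reduce L w :
  colored (reduce_listing L) w -> colored L w.
Proof.
elim: L w => [|l L IH] w //= /colored_cat[u1 [u2 [-> /letter_colored_reduce H1 /IH H2 H12]]].
by exists u1, u2.
Qed.

(** * From colored words to colorings of the listing poset *)

Definition listing_vertex (L : seq letter) (p : 'I_(size L))
    (x : letter_vertex (tnth (in_tuple L) p)) : listing_poset L := existT _ p x.

Lemma incomp_listing (L : seq letter) (x y : listing_poset L) :
  incomp x y = [&& x != y, ~~ listing_lt x y & ~~ listing_lt y x].
Proof.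
rewrite /incomp /Order.comparable !le_eqVlt negb_or !negb_or [y == x]eq_sym.
by rewrite andbACA andbb.
Qed.

Lemma incomp_listing_sym (L : seq letter) (x y : listing_poset L) :
  incomp x y = incomp y x.
Proof. by rewrite /incomp comparable_sym. Qed.

Lemma incomp_listing_ltn (L : seq letter) (x y : listing_poset L) :
  tag x < tag y ->
  incomp x y = (level x == level y) || (level x == (level y).+1).
Proof.
move=> xy; rewrite incomp_listing.
have -> : x != y by apply: contraTneq xy => ->; rewrite ltnn.
rewrite /listing_lt -(inj_eq val_inj) -[tag y == _](inj_eq val_inj) xy.
by rewrite (ltn_eqF xy) (gtn_eqF xy) ltnNge (ltnW xy) /=; lia.
Qed.

Lemma incomp_listing_eq (L : seq letter) p
    (x y : letter_vertex (tnth (in_tuple L) p)) :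
  letter_level x <= letter_level y ->
  incomp (listing_vertex x) (listing_vertex y) =
  (x != y) && ((letter_level x == letter_level y)
               || (letter_level y == (letter_level x).+1) && ~~ letter_edge x y).
Proof.
move=> xy; rewrite incomp_listing /listing_vertex eq_Tagged /listing_lt /level /=.
rewrite eqxx ltnn !tagged_asE.
move: (letter_level x) (letter_level y) xy => m n mn /=.
by case: (x != y); case: (letter_edge x y); case: (letter_edge y x) => //=; lia.
Qed.

(** Indexing the blocks by position matches the vertices of [listing_poset], which carry the
    position of their part. *)
Lemma colored_pieces l0 L u :
  colored L u <-> exists ws : nat -> seq (nat * nat),
   [/\ u = flatten (mkseq ws (size L)),
       forall p, p < size L -> letter_colored (nth l0 L p) (ws p)
     & forall p q, p < q < size L -> allrel compatible (ws p) (ws q)].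
Proof.
have mkseqE ws n : mkseq ws n.+1 = ws 0 :: mkseq (fun p => ws p.+1) n.
  by rewrite /mkseq /= (iotaDl 1 0) -map_comp.
elim: L u => [|l L IH] u.
  by split=> [->|[ws [-> //]]]; exists (fun=> [::]); split=> // p q; rewrite ltn0 andbF.
rewrite -[size (l :: L)]/(size L).+1.
split=> [[u1 [u2 [-> u1P /IH[ws [u2E wsP wsR]] u12]]] | [ws [-> wsP wsR]]].
  exists (fun p => if p is p'.+1 then ws p' else u1); rewrite mkseqE /= -u2E.
  split=> // [[|p] // pL | [|p] [|q] //= pq]; first exact: (wsP p pL);
    last exact: (wsR p q pq).
  apply/allrelP => x y xu1 yq; apply: (allrelP u12) => //.
  rewrite u2E; apply/flattenP; exists (ws q) => //.
  by apply/mapP; exists q => //; rewrite mem_iota.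
exists (ws 0), (flatten (mkseq (fun p => ws p.+1) (size L))); rewrite mkseqE.
split=> //; first exact: (wsP 0).
  apply/IH; exists (fun p => ws p.+1); split=> // [p pL|p q pq].
    exact: (wsP p.+1 pL).
  exact: (wsR p.+1 q.+1 pq).
apply/allrelP => x y x0 /flattenP[_ /mapP[q + ->] yq].
rewrite mem_iota /= => qL; exact: (allrelP (wsR 0 q.+1 qL)).
Qed.

Lemma count_letter_word (l : letter) (g : letter_vertex l -> nat) u c :
  perm_eq u (letter_word g) -> count_mem c (map snd u) = #|[set x | g x == c]|.
Proof.
move=> uP; rewrite (seq.permP (perm_map snd uP)) /letter_word -map_comp count_map.
rewrite -size_filter cardE; apply: perm_size; apply: uniq_perm.
- by rewrite filter_uniq ?enum_uniq.
- exact: enum_uniq.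
by move=> x; rewrite mem_filter !mem_enum /= inE andbT.
Qed.

Lemma card_color_listing (L : seq letter) (f : listing_poset L -> nat) c :
  #|[set v | f v == c]| =
  \sum_(p < size L)
    #|[set x : letter_vertex (tnth (in_tuple L) p) | f (listing_vertex x) == c]|.
Proof.
rewrite -sum1_card (eq_bigl (fun v => f v == c)) => [|v]; last by rewrite inE.
rewrite (eq_bigr (fun p : 'I_(size L) =>
  \sum_(x : letter_vertex (tnth (in_tuple L) p) | f (listing_vertex x) == c) 1)); last first.
  by move=> p _; rewrite -sum1_card; apply: eq_bigl => x; rewrite inE.
rewrite (sig_big_dep _ (fun p x => f (listing_vertex x) == c)) /=.
by apply: eq_bigl => -[p x].
Qed.

Lemma count_flatten_mkseq (ws : nat -> seq (nat * nat)) n c :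
  count_mem c (map snd (flatten (mkseq ws n))) =
  \sum_(p < n) count_mem c (map snd (ws p)).
Proof.
rewrite map_flatten count_flatten sumnE !big_map.
rewrite -(big_mkord xpredT (fun p => count_mem c (map snd (ws p)))).
by rewrite /index_iota subn0.
Qed.

(** A coloring is recorded as its pairs (level, color), part by part: across parts [compatible] is
    exactly the condition for incomparable vertices, and inside a part [letter_proper] is. *)
Lemma realizes_listing L N :
  realizes (@incomp _ (listing_poset L)) N <->
  exists2 u, colored L u & forall c, count_mem c (map snd u) = N c.
Proof.
pose l0 := vletter 0.
split=> [[f /proper_coloringP fP fN] | [u /(colored_pieces l0)[ws [uE wsP wsR]] uN]].
  pose ws p := if insub p is Some p' then
    letter_word (fun x : letter_vertex (tnth (in_tuple L) p') => f (listing_vertex x))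
    else [::].
  have wsE (p : 'I_(size L)) : ws p =
      letter_word (fun x : letter_vertex (tnth (in_tuple L) p) => f (listing_vertex x)).
    by rewrite /ws valK.
  exists (flatten (mkseq ws (size L))).
    apply/(colored_pieces l0); exists ws; split=> // [p pL | p q /andP[pq qL]].
      rewrite -[p]/(val (Ordinal pL)) wsE -[nth _ _ _](tnth_nth l0 (in_tuple L)).
      exists (fun x => f (listing_vertex x)) => // x y xy H.
      apply: fP; rewrite incomp_listing_eq; first by rewrite xy.
      by case/orP: H => [/eqP->|/andP[/eqP->]].
    have pL := ltn_trans pq qL.
    rewrite -[p]/(val (Ordinal pL)) -[q]/(val (Ordinal qL)) !wsE.
    apply/allrelP => _ _ /mapP[x _ ->] /mapP[y _ ->]; apply/implyP => /= H.
    by apply: fP; rewrite incomp_listing_ltn.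
  move=> c; rewrite count_flatten_mkseq -fN card_color_listing.
  by apply: eq_bigr => p _; apply: count_letter_word; rewrite wsE.
have /fin_all_exists[g gP] (p : 'I_(size L)) :
    exists g : letter_vertex (tnth (in_tuple L) p) -> nat,
    letter_proper g /\ perm_eq (ws p) (letter_word g).
  by have := wsP p (ltn_ord p); rewrite -(tnth_nth l0 (in_tuple L)) => -[g]; exists g.
exists (fun v => g (tag v) (tagged v)) => [|c]; last first.
  rewrite card_color_listing -uN uE count_flatten_mkseq.
  by apply: eq_bigr => p _; rewrite (count_letter_word _ (proj2 (gP p))).
apply/proper_coloringP => x y.
(* Incomparability and the conclusion are symmetric, so [x] may be taken in the earlier part or,
   within one part, on the lower level. *)
wlog xy : x y / tag x < tag y \/ tag x = tag y /\ level x <= level y.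
  move=> H; have [xy|yx|/val_inj xy] := ltngtP (tag x) (tag y).
  - by apply: H; left.
  - by rewrite eq_sym incomp_listing_sym; apply: H; left.
  - have [lxy|/ltnW lyx] := leqP (level x) (level y); first by apply: H; right.
    by rewrite eq_sym incomp_listing_sym; apply: H; right.
case: x y xy => [p x] [q y] /= [pq|[E]].
  rewrite incomp_listing_ltn // => lxy.
  have in_ws r (z : letter_vertex (tnth (in_tuple L) r)) : (letter_level z, g r z) \in ws r.
    rewrite (perm_mem (proj2 (gP r))); apply/mapP; exists z => //.
    by rewrite mem_enum.
  have pqL : p < q < size L by rewrite pq ltn_ord.
  by have /implyP := allrelP (wsR p q pqL) _ _ (in_ws p x) (in_ws q y); apply.
move: y; rewrite -{q}E => y lxy; rewrite incomp_listing_eq // => /andP[].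
exact: (proj1 (gP p)).
Qed.

(** Reduction preserves colored words up to permutation, hence the number of occurrences of each
    color. *)
Lemma realizes_reduce L N :
  realizes (@incomp _ (listing_poset L)) N <->
  realizes (@incomp _ (listing_poset (reduce_listing L))) N.
Proof.
rewrite !realizes_listing; split=> [] [u].
  move=> /reduce_colored[w uw wP] uN; exists w => // c.
  by rewrite -uN (seq.permP (perm_map snd uw)).
by move=> /colored_reduce; exists u.
Qed.

Lemma poset_iso_incomp disp disp' (P : finPOrderType disp) (Q : finPOrderType disp') :
  poset_iso P Q -> graph_iso (@incomp _ P) (@incomp _ Q).
Proof.
by case=> phi phi_bij phiE; exists phi => // x y; rewrite /incomp /Order.comparable !phiE.
Qed.

(** * Indifference graphs *)

Lemma count_split (a : pred nat) m v : m <= v ->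
  count a (iota 0 v) = count a (iota 0 m) + count a (iota m (v - m)).
Proof. by move=> mv; rewrite -{1}(subnKC mv) iotaD count_cat. Qed.

Lemma leq_count_take (T : Type) (a : pred T) (s : seq T) i j :
  i <= j -> count a (take i s) <= count a (take j s).
Proof.
move=> ij; rewrite -(cat_take_drop i (take j s)) take_takel // count_cat.
exact: leq_addr.
Qed.

(** Later east steps sit at larger positions, and a longer prefix contains at least as many north
    steps. *)
Lemma hess_mono n d i j : is_dyck n d -> i <= j -> j < n -> hess d i <= hess d j.
Proof.
case=> _ dE _ ij jn; apply: leq_count_take.
set es := [seq p <- _ | _].
(* With exactly [n] east steps, both indices are in range and [nth] does not fall back on its
   default. *)
have es_size : size es = n.
  rewrite -dE size_filter -[d in RHS](mkseq_nth true) count_map.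
  by apply: eq_count => p /=; rewrite /preim /=.
have es_sorted : sorted leq es.
  by apply: sorted_filter; [exact: leq_trans | exact: iota_sorted].
by apply: (sorted_leq_nth leq_trans leqnn) => //; rewrite inE es_size //; lia.
Qed.

(** * The greedy coloring *)

Lemma mexP s : mex s \notin s.
Proof.
rewrite /mex; set r := iota 0 (size s).+1.
(* Pigeonhole: the [size s + 1] candidates cannot all lie in [s]. *)
have H : has (fun c => c \notin s) r.
  rewrite -[has _ _]negbK has_predC negbK; apply/negP => /allP sub.
  by have := uniq_leq_size (iota_uniq 0 (size s).+1) sub; rewrite size_iota ltnn.
have := nth_find 0 H; rewrite nth_iota //.
by rewrite -[X in _ < X](size_iota 0) -has_find.
Qed.

Lemma mex_min s c : c < mex s -> c \in s.
Proof.
move=> cs; have := before_find 0 cs; rewrite nth_iota ?add0n => [/negbFE //|].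
by rewrite (leq_trans cs) // /mex -[X in _ <= X](size_iota 0) find_size.
Qed.

Section Greedy.
Variable e : rel nat.

(** Later stages never recolor a vertex, so its color can be read off right after it is
    processed. *)
Definition greedy_color v := nth 0 (greedy e v.+1) v.

Lemma size_greedy m : size (greedy e m) = m.
Proof. by elim: m => //= m IH; rewrite size_rcons IH. Qed.

Lemma nth_greedy m v : v < m -> nth 0 (greedy e m) v = greedy_color v.
Proof.
elim: m => // m IH; rewrite ltnS leq_eqVlt => /orP[/eqP-> // | vm].
by rewrite /= nth_rcons size_greedy vm IH.
Qed.

Lemma greedy_colorE v :
  greedy_color v = mex [seq greedy_color i | i <- iota 0 v & e i v].
Proof.
rewrite /greedy_color /= nth_rcons size_greedy ltnn eqxx; congr mex.
apply/eq_in_map => i; rewrite mem_filter mem_iota => /and3P[_ _ iv].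
exact: nth_greedy.
Qed.

Lemma greedy_color_neq i v : i < v -> e i v -> greedy_color i != greedy_color v.
Proof.
move=> iv eiv; apply: contraTneq (mexP [seq greedy_color i | i <- iota 0 v & e i v]).
rewrite -greedy_colorE => <-; rewrite negbK; apply: map_f.
by rewrite mem_filter eiv mem_iota.
Qed.

(** A vertex receives a color that is at least [m] only when every color below [m] already occurs on
    an earlier neighbor. *)
Lemma greedy_color_full v m : m <= greedy_color v ->
  m <= count (fun i => e i v && (greedy_color i < m)) (iota 0 v).
Proof.
rewrite greedy_colorE => mv; rewrite -size_filter -(size_map greedy_color).
rewrite -[m in m <= _](size_iota 0); apply: uniq_leq_size (iota_uniq 0 m) _ => c.
rewrite mem_iota add0n /= => cm; have /mapP[i iP cE] := mex_min (leq_trans cm mv).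
move: iP; rewrite mem_filter => /andP[eiv iv]; rewrite cE; apply: map_f.
by rewrite mem_filter eiv -cE cm iv.
Qed.

End Greedy.

Section Indifference.
Variables (n : nat) (h : nat -> nat).
Hypothesis h_mono : forall i j, i <= j -> j < n -> h i <= h j.

Definition indiff_proper (f : nat -> nat) : Prop :=
  forall i j, i < j -> j < n -> j < h i -> f i != f j.

(** As [h] is monotone, once a vertex reaches beyond [v] all later ones do. The case [l = v] means
    that there are no earlier neighbors. *)
Lemma earlier_neighbors v : v < n ->
  exists2 l, l <= v & forall u, u < v -> (v < h u) = (l <= u).
Proof.
move=> vn; pose l := find (fun u => v < h u) (iota 0 v).
have lv : l <= v by rewrite -[X in _ <= X](size_iota 0) find_size.
exists l => // u uv; have [lu|ul] := leqP l u.
  have lv' : l < v := leq_ltn_trans lu uv.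
  have H : has (fun u => v < h u) (iota 0 v) by rewrite has_find size_iota.
  apply: leq_trans (h_mono lu (ltn_trans uv vn)).
  by have := nth_find 0 H; rewrite -/l nth_iota.
by have := before_find 0 ul; rewrite nth_iota // (ltn_trans ul).
Qed.

(** The vertices from [l] to [v] form a clique, so [f] is injective there; [v] itself uses up one of
    the [m] colors. *)
Lemma neighbors_few f m v l : indiff_proper f -> v < n -> l <= v ->
  (forall u, u < v -> (v < h u) = (l <= u)) -> f v < m ->
  count (fun u => f u < m) (iota l (v - l)) < m.
Proof.
move=> fP vn lv lE fvm; rewrite -size_filter; set s := filter _ _.
have sP u : u \in s -> [/\ f u < m, l <= u & u < v].
  by rewrite mem_filter mem_iota subnKC // => /and3P.
rewrite -[X in _ <= X](size_iota 0) -(size_map f) -[_.+1]/(size (f v :: map f s)).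
apply: uniq_leq_size; last first.
  move=> c; rewrite inE mem_iota add0n => /orP[/eqP-> // | /mapP[u /sP[? _ _] ->] //].
have fne u w : l <= u -> u < w -> w <= v -> f u != f w.
  move=> lu uw wv; apply: fP => //; first exact: leq_ltn_trans vn.
  by apply: (leq_ltn_trans wv); rewrite lE // (leq_trans uw).
rewrite /= map_inj_in_uniq ?filter_uniq ?iota_uniq ?andbT //.
  by apply/mapP => -[u /sP[_ lu uv] /eqP]; rewrite eq_sym (negbTE (fne _ _ lu uv _)).
move=> u w /sP[_ lu uv] /sP[_ lw wv] E; apply/eqP.
case: ltngtP => // [uw|wu].
  by have := fne u w lu uw (ltnW wv); rewrite E eqxx.
by have := fne w u lw wu (ltnW uv); rewrite E eqxx.
Qed.

(* Let l be the first neighbor of v.  If the greedy set misses v, it has at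
   least m vertices in [l, v), where f has fewer than m; so a deficit just after v
   would force a deficit before l. *)
Lemma greedy_dominates (e : rel nat) f m v : indiff_proper f ->
  (forall i j, i < j -> e i j = (j < h i)) -> v <= n ->
  count (fun u => f u < m) (iota 0 v)
    <= count (fun u => greedy_color e u < m) (iota 0 v).
Proof.
move=> fP eE; have [k] := ubnP v; elim: k v => // k IH [|v] // vk vn.
have Hv := IH v vk (ltnW vn).
rewrite -addn1 !iotaD !count_cat /= !addn0.
have [gvm|gvm] := ltnP (greedy_color e v) m; first by apply: leq_add => //; case: (f v < m).
have [fvm|_] := ltnP (f v) m; last by rewrite !addn0.
have [l lv lE] := earlier_neighbors vn.
have := IH l (leq_ltn_trans lv vk) (leq_trans lv (ltnW vn)).
have := neighbors_few fP vn lv lE fvm.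
have := greedy_color_full gvm.
(* No neighbor of [v] precedes [l], so the whole count of [greedy_color_full] falls in the interval
   from [l] on. *)
rewrite !(count_split _ lv) [X in _ <= X + _ -> _](_ : _ = 0); last first.
  apply/eqP; rewrite -leqn0 leqNgt -has_count; apply/hasPn => u.
  rewrite mem_iota add0n /= => ul; have uv := leq_trans ul lv.
  by rewrite eE // lE // leqNgt ul.
have : count (fun i => e i v && (greedy_color e i < m)) (iota l (v - l))
    <= count (fun u => greedy_color e u < m) (iota l (v - l)).
  by apply: sub_count => u /andP[].
rewrite /=; lia.
Qed.

(* The two color classes are exchanged from q on, where q is the least vertex
   after which a no longer outnumbers b; the choice of q makes the cut proper. *)
Lemma robin_hood_indiff f a b : indiff_proper f ->
  count (pred1 b \o f) (iota 0 n) < count (pred1 a \o f) (iota 0 n) ->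
  exists2 f', indiff_proper f' & forall c, count (pred1 c \o f') (iota 0 n) =
    if c == a then (count (pred1 a \o f) (iota 0 n)).-1
    else if c == b then (count (pred1 b \o f) (iota 0 n)).+1
    else count (pred1 c \o f) (iota 0 n).
Proof.
move=> fP ab.
have ab_neq : a != b by apply: contraTneq ab => ->; rewrite ltnn.
pose T c v := count (pred1 c \o f) (iota v (n - v)).
have TS c v : v < n -> T c v = (f v == c) + T c v.+1.
  by move=> vn; rewrite /T (_ : n - v = (n - v.+1).+1) //; lia.
have exT : exists v, T a v <= T b v by exists n; rewrite /T subnn.
case: (ex_minnP exT) => p pT pmin.
have T0 c : T c 0 = count (pred1 c \o f) (iota 0 n) by rewrite /T subn0.
have pn : p <= n by apply: pmin; rewrite /T subnn.
(* The least [p] is positive, because [a] outnumbers [b] on the full range; the exchange starts at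
   its predecessor [q]. *)
case: p => [|q] in pT pmin pn *; first by move: pT; rewrite !T0; lia.
have qT v : v <= q -> T b v < T a v.
  by move=> vq; rewrite ltnNge; apply/negP => /pmin; lia.
have fq : f q = a.
  apply/eqP; have := qT q (leqnn q); rewrite (TS a q) // (TS b q) //; case: (f q == a) => //.
  by rewrite ltnNge (leq_trans pT) // leq_addl.
(* The excess of [a] over [b] from [q] on is exactly one, so the exchange moves a single vertex. *)
have Tq : T a q = (T b q).+1.
  by have := qT q (leqnn q); rewrite (TS a q) // (TS b q) // fq eqxx (negbTE ab_neq); lia.
pose sw c := if c == a then b else if c == b then a else c.
have swK : involutive sw.
  move=> c; rewrite /sw; case: (eqVneq c a) => [->|ca].
    by rewrite eqxx eq_sym (negbTE ab_neq).
  by case: (eqVneq c b) => [->|cb]; rewrite ?eqxx // (negbTE ca) (negbTE cb).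
have sw_inj := inv_inj swK.
exists (fun u => if u < q then f u else sw (f u)).
  move=> i j ij jn hij.
  case: (ltnP j q) => jq; first by rewrite (ltn_trans ij jq) fP.
  case: (ltnP i q) => iq; last by rewrite (inj_eq sw_inj) fP.
  (* Since [q] has color [a], no earlier vertex of color [a] is adjacent to it. *)
  have hi_q : f i = a -> h i <= q.
    by move=> fi; rewrite leqNgt; apply/negP => /(fP i q iq pn); rewrite fi fq eqxx.
  rewrite /sw; case: (eqVneq (f j) a) => [fj|_].
    (* Here [i] has color [b] and [j] becomes [b]. Between [i] and [q] color [a] occurs at least as
       often as [b], so some [w] there has color [a]. Then [h i <= h w <= q <= j], against the
       adjacency of [i] and [j]. *)
    apply/eqP => fi.
    have [w /andP[iw wq] fw] : exists2 w, i < w < q & f w = a.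
      have : has (pred1 a \o f) (iota i (q - i)).
        have cut c : T c i = count (pred1 c \o f) (iota i (q - i)) + T c q.
          rewrite /T (_ : n - i = (q - i) + (n - q)); last by lia.
          by rewrite iotaD count_cat subnKC // ltnW.
        rewrite has_count; have := qT i (ltnW iq); rewrite !cut Tq.
        have : 0 < count (pred1 b \o f) (iota i (q - i)).
          rewrite -has_count; apply/hasP; exists i; last by rewrite /= fi.
          by rewrite mem_iota; lia.
        lia.
      case/hasP => w; rewrite mem_iota subnKC ?(ltnW iq) // => /andP[iw wq] /eqP fw.
      exists w => //; rewrite wq andbT ltn_neqAle iw andbT.
      by apply: contraNneq ab_neq => wi; rewrite -fw -wi fi.
    have := h_mono (ltnW iw) (ltn_trans wq pn).
    have : h w <= q by rewrite leqNgt; apply/negP => /(fP w q wq pn); rewrite fw fq eqxx.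
    lia.
  case: (eqVneq (f j) b) => [fj|_]; last by apply: fP.
  by apply/eqP => /hi_q; lia.
move=> c; rewrite !(count_split _ (ltnW pn)).
have -> : count (pred1 c \o (fun u => if u < q then f u else sw (f u))) (iota 0 q)
    = count (pred1 c \o f) (iota 0 q).
  by apply: eq_in_count => u; rewrite mem_iota add0n /= => ->.
have -> : count (pred1 c \o (fun u => if u < q then f u else sw (f u))) (iota q (n - q))
    = T (sw c) q.
  apply: eq_in_count => u; rewrite mem_iota /= => /andP[qu _].
  by rewrite ltnNge qu /= -[c in LHS]swK (inj_eq sw_inj).
rewrite -!/(T _ q) /sw; case: (eqVneq c a) => [->|ca]; first by rewrite Tq addnS.
by case: (eqVneq c b) => [->|cb] //; rewrite Tq addnS.
Qed.

End Indifference.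

(** * Dominated integer vectors *)

Section RadoIntegral.
Variable k : nat.
Implicit Types (al be : {ffun 'I_k -> nat}) (i j : 'I_k) (m : nat).

Definition prefix_sum al m := \sum_(i < k | i < m) al i.

Definition transfer i j be : {ffun 'I_k -> nat} :=
  [ffun l => if l == i then (be i).-1 else if l == j then (be j).+1 else be l].

Lemma prefix_sumS al i : prefix_sum al i.+1 = prefix_sum al i + al i.
Proof.
rewrite /prefix_sum (bigD1 i) //= addnC; congr (_ + _).
by apply: eq_bigl => j; rewrite ltnS ltn_neqAle andbC.
Qed.

Lemma prefix_sum0 al : prefix_sum al 0 = 0.
Proof. by rewrite /prefix_sum big_pred0. Qed.

Lemma prefix_sum_all al m : k <= m -> prefix_sum al m = \sum_i al i.
Proof. by move=> km; apply: eq_bigl => i; apply: leq_trans km. Qed.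

(** One unit moves from [i] to [j]. The equation is stated additively to avoid truncated
    subtraction; [be j < be i] ensures that the predecessor of [be i] is a true decrement. *)
Lemma sum_transfer (P : pred 'I_k) i j be : be j < be i ->
  \sum_(l | P l) transfer i j be l + P i = \sum_(l | P l) be l + P j.
Proof.
move=> ij; have ji : j != i by apply: contraTneq ij => ->; rewrite ltnn.
have E (F : 'I_k -> nat) : \sum_(l | P l) F l =
    P i * F i + P j * F j + \sum_(l | P l && (l != i) && (l != j)) F l.
  have D (Q : pred 'I_k) l : \sum_(x | Q x) F x = Q l * F l + \sum_(x | Q x && (x != l)) F x.
    by case: (boolP (Q l)) => Ql; [rewrite mul1n (bigD1 l) | rewrite mul0n add0n;
      apply: eq_bigl => x; case: eqVneq => [->|_]; rewrite ?andbT // (negbTE Ql)].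
  by rewrite (D P i) (D _ j) ji andbT addnA.
rewrite !E /transfer !ffunE eqxx (negbTE ji) eqxx.
rewrite (eq_bigr be) => [|l].
  move: (\sum_(_ | _) _) (be i) (be j) ij => ? x y xy.
  by case: (P i); case: (P j); rewrite ?mul1n ?mul0n; lia.
move=> /andP[/andP[_ li] lj]; by rewrite ffunE (negbTE li) (negbTE lj).
Qed.

(* Only [al] needs to be sorted: at the first index [i] where the prefix sums
   differ and the next index [j] where they agree again,
   [be i > al i >= al j > be j]. *)
Lemma rado_sorted (Q : {ffun 'I_k -> nat} -> Prop) al be :
  (forall i j be, be j < be i -> Q be -> Q (transfer i j be)) ->
  (forall i j, i <= j -> al j <= al i) ->
  (forall m, prefix_sum al m <= prefix_sum be m) ->
  \sum_i al i = \sum_i be i ->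
  Q be -> Q al.
Proof.
move=> Qtransfer al_sorted.
(* Induction on the total excess of the prefix sums of [be] over those of [al]. *)
have [N] := ubnP (\sum_(m < k) (prefix_sum be m - prefix_sum al m)).
elim: N be => // N IH be beN le_pre eq_tot Qbe.
case: (boolP [forall m : 'I_k, prefix_sum be m == prefix_sum al m]) => [/forallP eq_pre|].
  suff -> : al = be by [].
  apply/ffunP => i; apply/eqP; rewrite -(eqn_add2l (prefix_sum al i)) -prefix_sumS.
  rewrite -(eqP (eq_pre i)) -prefix_sumS eq_sym; apply/eqP.
  have [ik|ki] := ltnP i.+1 k; first exact/eqP/(eq_pre (Ordinal ik)).
  by rewrite !prefix_sum_all.
move=> /forallPn[m0 m0P].
have ex1 : exists m, prefix_sum be m != prefix_sum al m by exists m0.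
case: (ex_minnP ex1) => -[|i] ineq imin; first by rewrite !prefix_sum0 eqxx in ineq.
have ik : i < k.
  by rewrite ltnNge; apply: contra ineq => ki; rewrite !prefix_sum_all ?eq_tot // leqW.
have ieq : prefix_sum be i = prefix_sum al i.
  by apply/eqP/negPn/negP => /imin; rewrite ltnn.
have ex2 : exists m, (i.+1 < m) && (prefix_sum be m == prefix_sum al m).
  (* Beyond [k] the prefix sums are the full totals, and [i < k] gives [i.+1 < k.+1]. *)
  exists k.+1; rewrite !prefix_sum_all // eq_tot eqxx andbT; lia.
case: (ex_minnP ex2) => -[|j] // /andP[ij /eqP jeq] jmin.
have jneq m : i < m -> m <= j -> prefix_sum al m < prefix_sum be m.
  move=> im mj; rewrite ltn_neqAle le_pre andbT eq_sym.
  have [<-//|neq] := eqVneq i.+1 m; apply/negP => E.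
  have := jmin m; rewrite E andbT => /(_ _); lia.
have jk : j < k.
  rewrite ltnNge; apply/negP => kj; have := jneq j ij (leqnn j).
  by rewrite !prefix_sum_all ?eq_tot ?ltnn.
pose oi := Ordinal ik; pose oj := Ordinal jk.
have bi : al oi < be oi.
  have := prefix_sumS be oi; have := prefix_sumS al oi.
  have := jneq i.+1 (leqnn _) ij; rewrite /= ieq; lia.
have bj : be oj < al oj.
  have := prefix_sumS be oj; have := prefix_sumS al oj.
  have := jneq j ij (leqnn _); rewrite /= jeq; lia.
have bji : be oj < be oi.
  by apply: (leq_trans bj); apply: leq_trans (ltnW bi); apply: al_sorted; apply: ltnW.
have preE m : prefix_sum (transfer oi oj be) m + (i < m) = prefix_sum be m + (j < m).
  by have := sum_transfer (fun l : 'I_k => l < m) bji.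
apply: (IH (transfer oi oj be)); last exact: Qtransfer.
(* The prefix sum at [i.+1] drops by one, and [i.+1 <= j < k] puts this index in the range of the
   measure. *)
- have i1k : i.+1 < k := leq_ltn_trans (ij : i.+1 <= j) jk.
  rewrite ltnS in beN; apply: leq_trans beN.
  rewrite (bigD1 (Ordinal i1k)) //= [X in _ < X](bigD1 (Ordinal i1k)) //=.
  rewrite -addSn; apply: leq_add.
    have := preE i.+1; have := jneq i.+1 (leqnn _) ij; lia.
  apply: leq_sum => m _; have := preE m; lia.
(* Prefix sums drop only for [i < m <= j], where they were strictly larger than those of [al]. *)
- move=> m; have := preE m; have := le_pre m.
  have [im|] := ltnP i m; last by lia.
  have [jm|mj] := ltnP j m; first by lia.
  by have := jneq m im mj; lia.
- by rewrite eq_tot; apply/esym/(@addIn 1)/(sum_transfer xpredT bji).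
Qed.

Lemma sort_ffun al : exists s : 'S_k,
  forall i j, i <= j -> al (s j) <= al (s i).
Proof.
have szE : size (sort geq (codom al)) == k by rewrite size_sort size_codom card_ord.
have : perm_eq (Tuple szE) [tuple al i | i < k].
  by rewrite perm_sort /= /image_mem codomE enumT.
case/tuple_permP => s sE; exists s => i j ij.
have alE l : al (s l) = nth 0 (sort geq (codom al)) l.
  transitivity (tnth [tuple tnth [tuple al i0 | i0 < k] (s i0) | i0 < k] l).
    by rewrite !tnth_mktuple.
  by rewrite (tnth_nth 0) -sE.
have geq_tr : transitive geq by move=> y x z /= xy yz; apply: leq_trans xy.
have geq_rf : reflexive geq := leqnn.
have geq_tot : total geq by move=> x y; apply: leq_total.
rewrite !alE; apply: (sorted_leq_nth geq_tr geq_rf 0 (sort_sorted geq_tot _)) => //.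
  by rewrite inE (eqP szE).
by rewrite inE (eqP szE).
Qed.

(** Sorting [al] turns each of its prefix sums into a sum over a subset, which the hypothesis
    bounds; invariance of [Q] under permutations then undoes the sorting. *)
Lemma rado (Q : {ffun 'I_k -> nat} -> Prop) al be :
  (forall i j be, be j < be i -> Q be -> Q (transfer i j be)) ->
  (forall (s : 'S_k) be, Q be -> Q [ffun i => be (s i)]) ->
  (forall A : {set 'I_k}, \sum_(i in A) al i <= prefix_sum be #|A|) ->
  \sum_i al i = \sum_i be i ->
  Q be -> Q al.
Proof.
move=> Qtransfer Qperm le_sub eq_tot Qbe; have [s sP] := sort_ffun al.
suff /(Qperm s^-1%g) : Q [ffun i => al (s i)].
  by congr Q; apply/ffunP => i; rewrite !ffunE permKV.
have sumE (P : pred 'I_k) : \sum_(i | P i) [ffun i => al (s i)] i =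
    \sum_(i | P (s^-1%g i)) al i.
  rewrite [RHS](reindex_inj (@perm_inj _ s)); apply: eq_big => i; rewrite ?permK //.
  by rewrite ffunE.
apply: (rado_sorted Qtransfer _ _ _ Qbe) => [i j ij|m|]; first by rewrite !ffunE sP.
  rewrite [X in X <= _]sumE.
  have -> : \sum_(i | s^-1%g i < m) al i = \sum_(i in [set i | s^-1%g i < m]) al i.
    by apply: eq_bigl => i; rewrite inE.
  apply: (leq_trans (le_sub _)).
  have [mk|km] := leqP m k.
    rewrite (_ : #|_| = m) //.
    rewrite -(card_preimset _ (@perm_inj _ s)).
    rewrite -sum1_card (eq_bigl (fun i : 'I_k => i < m)) => [|i]; last by rewrite !inE permK.
    by rewrite big_ord_narrow // sum1_card card_ord.
  rewrite (prefix_sum_all _ (ltnW km)) /prefix_sum; set a := #|_|.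
  by rewrite [X in _ <= X](bigID (fun i : 'I_k => i < a)) leq_addr.
by rewrite sumE.
Qed.

End RadoIntegral.

(** * Color class sizes and their transport to the poset *)

Lemma sum_color_classes (T : finType) (C : eqType) (f : T -> C) (s : seq C) :
  uniq s -> \sum_(c <- s) #|[set v | f v == c]| = #|[set v | f v \in s]|.
Proof.
elim: s => [_|c s IH /= /andP[cs su]].
  by rewrite big_nil (_ : [set v | _] = set0) ?cards0 //; apply/setP => v; rewrite !inE.
have E : [set v | f v == c] :&: [set v | f v \in s] = set0.
  by apply/setP => v; rewrite !inE; case: eqVneq => // ->; rewrite (negbTE cs).
rewrite big_cons IH // -cardsUI E cards0 addn0.
by apply: eq_card => v; rewrite !inE.
Qed.

Lemma sum_colors_lt (T : finType) (f : T -> nat) m :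
  \sum_(c < m) #|[set v | f v == c]| = #|[set v | f v < m]|.
Proof.
rewrite -(big_mkord xpredT (fun c => #|[set v | f v == c]|)) sum_color_classes ?iota_uniq //.
by apply: eq_card => v; rewrite !inE mem_index_iota.
Qed.

Lemma nth_wt (T : finType) (f : T -> nat) c : nth 0 (wt f) c = #|[set v | f v == c]|.
Proof.
rewrite /wt; have [lt|ge] := ltnP c (\max_v (f v).+1); first by rewrite nth_mkseq.
rewrite nth_default ?size_mkseq //; apply/esym/eqP; rewrite cards_eq0.
apply/eqP/setP => v; rewrite !inE; apply/negP => /eqP fv.
by have := leq_trans (leq_bigmax (F := fun v => (f v).+1) v) ge; rewrite fv ltnn.
Qed.

Lemma sumn_take (s : seq nat) m : sumn (take m s) = \sum_(c < m) nth 0 s c.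
Proof.
elim: s m => [|a s IH] [|m]; rewrite ?big_ord0 //=.
  by rewrite big1 // => c _; rewrite nth_nil.
by rewrite big_ord_recl /= IH.
Qed.

(** A vertex whose color is at least [size s] would lie in a class of size zero, so the classes
    listed in [s] exhaust [T]. *)
Lemma sumn_classes (T : finType) (f : T -> nat) (s : seq nat) :
  (forall c, #|[set v | f v == c]| = nth 0 s c) -> sumn s = #|T|.
Proof.
move=> fs; rewrite -(take_size s) sumn_take.
rewrite -(eq_bigr _ (fun (c : 'I_(size s)) _ => fs c)) sum_colors_lt.
rewrite -cardsT; apply: eq_card => v; rewrite !inE ltnNge; apply/negP => sv.
have := fs (f v); rewrite nth_default // => /eqP; rewrite cards_eq0.
by move=> /eqP/setP/(_ v); rewrite !inE eqxx.
Qed.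

Lemma sum_count_classes (F : nat -> nat) s m :
  \sum_(c < m) count (pred1 (c : nat) \o F) s = count (fun u => F u < m) s.
Proof.
elim: s => [|u s IH] /=; first by rewrite big1.
rewrite big_split /= IH; congr (_ + _).
have [Fm|Fm] := ltnP (F u) m.
  rewrite (bigD1 (Ordinal Fm)) //= eqxx big1 // => c cF.
  by apply/eqP; rewrite eqb0 eq_sym -(inj_eq val_inj) in cF *.
by rewrite big1 // => c _; rewrite gtn_eqF // (leq_trans (ltn_ord c)).
Qed.

Lemma card_class_ord n (F : nat -> nat) c :
  #|[set v : 'I_n | F v == c]| = count (pred1 c \o F) (iota 0 n).
Proof.
rewrite -val_enum_ord count_map -size_filter cardE; apply: perm_size.
apply: uniq_perm; [exact: enum_uniq | by rewrite filter_uniq ?enum_uniq | move=> x].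
by rewrite mem_enum mem_filter mem_enum inE andbT.
Qed.

Lemma realizes_indiff n d N : realizes (@indiff_graph n d) N <->
  exists2 F, indiff_proper n (hess d) F
    & forall c, count (pred1 c \o F) (iota 0 n) = N c.
Proof.
split=> [[f /proper_coloringP fP fN] | [F FP FN]].
  pose F u := oapp f 0 (insub u).
  have FE (v : 'I_n) : F v = f v by rewrite /F valK.
  exists F => [i j ij jn jh|c].
    rewrite -[i]/(val (Ordinal (ltn_trans ij jn))) -[j]/(val (Ordinal jn)) !FE.
    by apply: fP; rewrite /indiff_graph /indiff /= ij jh.
  by rewrite -card_class_ord -fN; apply: eq_card => v; rewrite !inE FE.
exists (fun v : 'I_n => F v) => [|c]; last by rewrite card_class_ord.
apply/proper_coloringP => x y /orP[/andP[xy hxy]|/andP[yx hyx]]; first exact: FP.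
by rewrite eq_sym; apply: FP.
Qed.

Definition robin_hood (a b : nat) (N : nat -> nat) (c : nat) : nat :=
  if c == a then (N a).-1 else if c == b then (N b).+1 else N c.

(** The interface to the later sections, which treat an abstract graph: [lam] is attained, it
    dominates, and unit transfers stay realizable. All three are proved on the indifference graph
    and carried back along [realizesE]. *)
Lemma lambda_gr_spec disp (P : finPOrderType disp) lam : is_lambda_gr P lam ->
  [/\ realizes (@incomp disp P) (nth 0 lam),
      forall f : P -> nat, proper_coloring (@incomp disp P) f ->
        forall m, #|[set v | f v < m]| <= \sum_(c < m) nth 0 lam c
    & forall N a b, realizes (@incomp disp P) N -> N b < N a ->
        realizes (@incomp disp P) (robin_hood a b N)].
Proof.
case=> L [n [d [/poset_iso_incomp PL dP Ld ->]]].
have h_mono i j : i <= j -> j < n -> hess d i <= hess d j by apply: hess_mono.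
have realizesE N : realizes (@incomp disp P) N <->
    exists2 F, indiff_proper n (hess d) F
      & forall c, count (pred1 c \o F) (iota 0 n) = N c.
  by rewrite (realizes_iso _ PL) realizes_reduce (realizes_iso _ Ld) realizes_indiff.
have lamE c : nth 0 (lambda_gr_dyck n d) c =
    count (pred1 c \o greedy_color (indiff d)) (iota 0 n).
  rewrite nth_wt -card_class_ord; apply: eq_card => v.
  by rewrite !inE nth_greedy.
have indiffE i j : i < j -> indiff d i j = (j < hess d i).
  by move=> ij; rewrite /indiff ij [j < i]ltnNge (ltnW ij) orbF.
split.
- apply/realizesE; exists (greedy_color (indiff d)) => [i j ij jn jh|c].
    by apply: greedy_color_neq; rewrite ?indiffE.
  by rewrite lamE.
- move=> f fP m.
  (* The coloring [f] is replaced by a coloring [F] of the indifference graph with the same class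
     sizes, which can be compared with the greedy one. *)
  have /realizesE[F FP FN] : realizes (@incomp disp P) (fun c => #|[set v | f v == c]|).
    by exists f.
  rewrite -sum_colors_lt -(eq_bigr _ (fun (c : 'I_m) _ => FN c)).
  rewrite (eq_bigr _ (fun (c : 'I_m) _ => lamE c)) !sum_count_classes.
  exact: (greedy_dominates h_mono).
- move=> N a b /realizesE[F FP FN] ab; apply/realizesE.
  have [|F' F'P F'N] := robin_hood_indiff h_mono FP (a := a) (b := b); first by rewrite !FN.
  by exists F' => // c; rewrite F'N !FN.
Qed.

(** * Color class vectors with finitely many entries *)

Section ColorClassVectors.
Variables (T : finType) (e : rel T) (lam : seq nat).
Hypothesis lam_realized : realizes e (nth 0 lam).
Hypothesis lam_dominates : forall f : T -> nat, proper_coloring e f ->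
  forall m, #|[set v | f v < m]| <= \sum_(c < m) nth 0 lam c.
Hypothesis robin_hood_realized : forall N a b,
  realizes e N -> N b < N a -> realizes e (robin_hood a b N).

Definition partial_sum m := \sum_(c < m) nth 0 lam c.

(* Relabel the colors so that those listed in [s] come first. *)
Lemma card_colors_leq (f : T -> nat) (s : seq nat) : proper_coloring e f ->
  #|[set v | f v \in s]| <= partial_sum (size s).
Proof.
move=> /proper_coloringP fP.
pose r c := if c \in s then index c s else size s + c.
have r_lt c : (r c < size s) = (c \in s).
  by rewrite /r; case: ifP => cs; rewrite ?index_mem // ltnNge leq_addr.
have r_inj : injective r.
  move=> c c' E; have := r_lt c; rewrite E r_lt => cc'; move: E.
  rewrite /r -cc'; case: ifP => [c's|_ /addnI //].
  by apply: index_inj; rewrite -?cc'.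
have gP : proper_coloring e (r \o f).
  by apply/proper_coloringP => x y /fP; rewrite (inj_eq r_inj).
apply: leq_trans (lam_dominates gP (size s)).
by rewrite (eq_card (B := [set v | (r \o f) v < size s])) // => v; rewrite !inE r_lt.
Qed.

(** For a coloring realizing [lam], the classes [0, ..., i - 1] and [j] together are no larger than
    the first [i + 1] entries of [lam]; cancelling the first [i] leaves the claim. *)
Lemma lam_antitone i j : i <= j -> nth 0 lam j <= nth 0 lam i.
Proof.
rewrite leq_eqVlt => /orP[/eqP-> // | ij].
have [f fP fN] := lam_realized.
have := card_colors_leq (rcons (iota 0 i) j) fP.
rewrite -sum_color_classes; last first.
  by rewrite rcons_uniq iota_uniq mem_iota leq0n add0n -leqNgt ltnW.
rewrite size_rcons size_iota /partial_sum big_ord_recr /= -cats1 big_cat /= big_seq1 fN.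
rewrite (eq_bigr _ (fun c _ => fN c)) -(big_mkord xpredT (nth 0 lam)).
by rewrite /index_iota subn0 leq_add2l.
Qed.

Lemma partial_sum_mono m m' : m <= m' -> partial_sum m <= partial_sum m'.
Proof.
move=> mm; rewrite /partial_sum -!(big_mkord xpredT (nth 0 lam)).
by rewrite [X in _ <= X](big_cat_nat (n := m)) //= leq_addr.
Qed.

Lemma sumn_lam : sumn lam = #|T|.
Proof. by have [f _ fN] := lam_realized; apply: sumn_classes fN. Qed.

Lemma partial_sum_leq m : partial_sum m <= #|T|.
Proof.
rewrite -sumn_lam -[in X in _ <= X](cat_take_drop m lam) sumn_cat sumn_take.
exact: leq_addr.
Qed.

Lemma lam_dominates_wt (f : T -> nat) : proper_coloring e f -> dominates lam (wt f).
Proof.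
move=> fP; split=> [|m].
  by rewrite sumn_lam; apply: (sumn_classes (f := f)) => c; rewrite nth_wt.
rewrite !sumn_take (eq_bigr _ (fun (c : 'I_m) _ => nth_wt f c)) sum_colors_lt.
exact: lam_dominates.
Qed.

Section Vectors.
Variable k : nat.
Implicit Types (al be : {ffun 'I_k -> nat}).

Definition vector_realized al : Prop :=
  exists2 f : T -> 'I_k, proper_coloring e f & forall i, #|[set v | f v == i]| = al i.

Definition extend al (c : nat) : nat := oapp al 0 (insub c).

Lemma extendE al (i : 'I_k) : extend al i = al i.
Proof. by rewrite /extend valK. Qed.

Lemma extend_default al c : k <= c -> extend al c = 0.
Proof. by move=> kc; rewrite /extend insubF // ltnNge kc. Qed.

Lemma vector_realizedP al : vector_realized al <-> realizes e (extend al).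
Proof.
split=> [[f /proper_coloringP fP fN] | [f /proper_coloringP fP fN]].
  exists (fun v => val (f v)) => [|c].
    by apply/proper_coloringP => x y /fP; rewrite (inj_eq val_inj).
  have [ck|kc] := ltnP c k.
    rewrite -[c]/(val (Ordinal ck)) extendE -fN; apply: eq_card => v.
    by rewrite !inE (inj_eq val_inj).
  rewrite extend_default //; apply/eqP; rewrite cards_eq0; apply/eqP/setP => v.
  by rewrite !inE; apply/negP => /eqP fv; have := ltn_ord (f v); rewrite fv ltnNge kc.
have f_lt v : f v < k.
  rewrite ltnNge; apply/negP => kf; have := fN (f v).
  rewrite extend_default // => /eqP; rewrite cards_eq0 => /eqP/setP/(_ v).
  by rewrite !inE eqxx.
exists (fun v => Ordinal (f_lt v)) => [|i].
  by apply/proper_coloringP => x y /fP.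
by rewrite -extendE -fN; apply: eq_card => v; rewrite !inE -(inj_eq val_inj).
Qed.

Lemma vector_realized_transfer i j al :
  al j < al i -> vector_realized al -> vector_realized (transfer i j al).
Proof.
move=> ij /vector_realizedP alP; apply/vector_realizedP.
have [||f fP fN] := @robin_hood_realized (extend al) i j; rewrite ?extendE //.
exists f => // c; rewrite fN /robin_hood !extendE.
have [ck|kc] := ltnP c k.
  by rewrite -[c]/(val (Ordinal ck)) !extendE ffunE !(inj_eq val_inj).
by rewrite !extend_default // !gtn_eqF // (leq_trans _ kc).
Qed.

Lemma vector_realized_perm (s : 'S_k) al :
  vector_realized al -> vector_realized [ffun i => al (s i)].
Proof.
move=> [f /proper_coloringP fP fN]; exists (fun v => (s^-1)%g (f v)) => [|i].
  by apply/proper_coloringP => x y /fP; rewrite (inj_eq perm_inj).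
rewrite ffunE -fN; apply: eq_card => v; rewrite !inE.
by rewrite -(inj_eq (@perm_inj _ s)) permKV.
Qed.

Lemma sum_vector_realized al : vector_realized al -> \sum_i al i = #|T|.
Proof.
move=> [f _ fN]; rewrite -(eq_bigr _ (fun i _ => fN i)) -cardsT.
rewrite -[index_enum _]enumT sum_color_classes ?enum_uniq //.
by apply: eq_card => v; rewrite !inE mem_enum.
Qed.

Lemma vector_realized_leq (A : {set 'I_k}) al :
  vector_realized al -> \sum_(i in A) al i <= partial_sum #|A|.
Proof.
move=> [f /proper_coloringP fP fN]; rewrite -(eq_bigr _ (fun i _ => fN i)).
rewrite -big_enum sum_color_classes ?enum_uniq //.
rewrite [#|A|]cardE -(size_map val).
have : proper_coloring e (val \o f).
  by apply/proper_coloringP => x y /fP; rewrite (inj_eq val_inj).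
move=> /(card_colors_leq [seq val i | i <- enum A]); apply: leq_trans.
by apply/subset_leq_card/subsetP => v; rewrite !inE; apply: map_f.
Qed.

Definition lam_vector : {ffun 'I_k -> nat} := [ffun i : 'I_k => nth 0 lam i].

Lemma prefix_sum_lam m : m <= k -> prefix_sum lam_vector m = partial_sum m.
Proof.
move=> mk; rewrite /prefix_sum big_ord_narrow; apply: eq_bigr => i _.
by rewrite ffunE.
Qed.

(** Since [lam] is weakly decreasing, it has at most [k] positive entries exactly when the first [k]
    entries already sum to the total. This is the test on which [permutahedron] branches. *)
Lemma count_lamP : reflect (partial_sum k = #|T|) (count (fun a => 0 < a) lam <= k).
Proof.
have zero : partial_sum k = #|T| <-> forall c, k <= c -> nth 0 lam c = 0.
  split=> [E c kc | z].
    apply/eqP; rewrite -leqn0 -(leq_add2l (partial_sum k)) addn0 {2}E.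
    apply: leq_trans (partial_sum_leq c.+1).
    by rewrite /partial_sum big_ord_recr /= leq_add2r partial_sum_mono.
  rewrite -sumn_lam /partial_sum -sumn_take -[in RHS](cat_take_drop k lam) sumn_cat.
  rewrite [X in _ + X](_ : _ = 0) ?addn0 // sumnE big_seq big1 // => a.
  by move=> /(nthP 0)[c _ <-]; rewrite nth_drop z // leq_addr.
apply: (iffP idP) => [ck | E].
  apply/zero => c kc; apply/eqP; rewrite -leqn0 leqNgt; apply/negP => lc.
  (* A positive entry at [c] forces all entries up to [c] to be positive, which is more than [k] of
     them. *)
  have : c.+1 <= count (fun a => 0 < a) lam.
    have cs : c < size lam by rewrite ltnNge; apply/negP => /(nth_default 0) E;
      rewrite E in lc.
    rewrite -[c.+1](size_takel cs) -(cat_take_drop c.+1 lam) count_cat.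
    rewrite cat_take_drop (_ : count _ (take _ _) = size (take c.+1 lam)) ?leq_addr //.
    apply/eqP; rewrite -all_count; apply/(all_nthP 0) => i.
    rewrite size_takel // => ic; rewrite nth_take //.
    by apply: leq_trans lc (lam_antitone _); rewrite -ltnS.
  by rewrite ltnNge (leq_trans ck kc).
rewrite -(cat_take_drop k lam) count_cat.
rewrite [X in _ + X](_ : _ = 0) ?addn0.
  by apply: leq_trans (count_size _ _) _; rewrite size_take_min geq_minl.
apply/eqP; rewrite -leqn0 leqNgt -has_count; apply/(hasPn) => a /(nthP 0)[c _ <-].
by rewrite nth_drop (proj1 zero E) // leq_addr.
Qed.

(** All [k] classes together contain every vertex, and dominance bounds them by the first [k]
    entries of [lam]. *)
Lemma vector_realized_fits al : vector_realized al -> partial_sum k = #|T|.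
Proof.
move=> alP; apply/eqP; rewrite eqn_leq partial_sum_leq -(sum_vector_realized alP).
have := vector_realized_leq setT alP; rewrite cardsT card_ord.
by rewrite (eq_bigl xpredT) // => i; rewrite inE.
Qed.

Lemma lam_vector_realized : partial_sum k = #|T| -> vector_realized lam_vector.
Proof.
move=> E; have [f fP fN] := lam_realized.
apply/vector_realizedP; exists f => // c; rewrite fN.
have [ck|kc] := ltnP c k; first by rewrite -[c]/(val (Ordinal ck)) extendE ffunE.
rewrite extend_default //.
apply/eqP; rewrite -leqn0 -(leq_add2l (partial_sum k)) addn0 {2}E.
apply: leq_trans (partial_sum_leq c.+1).
by rewrite /partial_sum big_ord_recr /= leq_add2r partial_sum_mono.
Qed.

Lemma sum_lam_vector : partial_sum k = #|T| -> \sum_i lam_vector i = #|T|.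
Proof. by move=> <-; rewrite -(prefix_sum_all _ (leqnn k)) prefix_sum_lam. Qed.

(** Applied with two choices of [Q]: being realized by a coloring, which gives saturation, and lying
    in the hull of the permutations of [lam], which gives the Newton polytope. *)
Lemma rado_lam (Q : {ffun 'I_k -> nat} -> Prop) al :
  (forall i j be, be j < be i -> Q be -> Q (transfer i j be)) ->
  (forall (s : 'S_k) be, Q be -> Q [ffun i => be (s i)]) ->
  partial_sum k = #|T| ->
  (forall A : {set 'I_k}, \sum_(i in A) al i <= partial_sum #|A|) ->
  \sum_i al i = #|T| ->
  Q lam_vector -> Q al.
Proof.
move=> Qt Qp kT le_sub tot; apply: (rado Qt Qp) => [A|].
  by rewrite prefix_sum_lam // -[X in _ <= X]card_ord max_card.
by rewrite tot sum_lam_vector.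
Qed.

End Vectors.
End ColorClassVectors.

(** * Newton polytopes *)

Section Hulls.
Local Open Scope ring_scope.
Variables (R : realType) (k : nat).
Implicit Types (S : classical_sets.set 'rV[R]_k) (x : 'rV[R]_k).

Lemma convex_hull_fin S (I : finType) (a : I -> R) (p : I -> 'rV[R]_k) :
  (forall i, 0 <= a i) -> \sum_i a i = 1 -> (forall i, S (p i)) ->
  convex_hull S (\sum_i a i *: p i).
Proof.
move=> a_ge0 a_sum pS.
exists #|I|, (a \o enum_val), (p \o enum_val); split=> [i||i|] //=.
  by rewrite -a_sum [RHS](reindex (@enum_val I I)) //; apply/onW_bij/enum_val_bij.
by rewrite [LHS](reindex (@enum_val I I)) //; apply/onW_bij/enum_val_bij.
Qed.

Lemma convex_hull_mem S x : S x -> convex_hull S x.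
Proof.
move=> Sx; have -> : x = \sum_(i < 1) 1 *: x by rewrite big_ord1 scale1r.
by apply: convex_hull_fin => //; rewrite big_ord1.
Qed.

Lemma convex_hull_mono S S' :
  (forall x, S x -> S' x) -> forall x, convex_hull S x -> convex_hull S' x.
Proof.
by move=> SS' x [n [a [p [a0 a1 pS ->]]]]; exists n, a, p; split=> // i; apply: SS'.
Qed.

(** Nested convex combinations flatten to one indexed by dependent pairs, with the coefficients
    multiplied. *)
Lemma convex_hull_idem S x : convex_hull (convex_hull S) x -> convex_hull S x.
Proof.
move=> [n [a [p [a0 a1 pS ->]]]].
(* The length, weights and points for each [i] are packed into one value, so that a single finite
   choice selects them all. *)
have /fin_all_exists[t tP] (i : 'I_n) :
    exists t : {m : nat & (('I_m -> R) * ('I_m -> 'rV[R]_k))%type},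
    [/\ forall j, 0 <= (tagged t).1 j, \sum_j (tagged t).1 j = 1,
        forall j, S ((tagged t).2 j)
      & p i = \sum_j (tagged t).1 j *: (tagged t).2 j].
  by have [m [b [q H]]] := pS i; exists (existT _ m (b, q)).
pose J i := [the finType of 'I_(tag (t i))].
pose c (u : {i : 'I_n & J i}) := a (tag u) * (tagged (t (tag u))).1 (tagged u).
pose q (u : {i : 'I_n & J i}) := (tagged (t (tag u))).2 (tagged u).
have sigE (V : nmodType) (F : forall i, J i -> V) :
    \sum_u F (tag u) (tagged u) = \sum_i \sum_j F i j.
  by rewrite (sig_big_dep xpredT (fun _ _ => true)).
have -> : \sum_i a i *: p i = \sum_u c u *: q u.
  rewrite (sigE _ (fun i (j : J i) => (a i * (tagged (t i)).1 j) *: (tagged (t i)).2 j)).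
  apply: eq_bigr => i _; have [_ _ _ ->] := tP i.
  by rewrite scaler_sumr; apply: eq_bigr => j _; rewrite scalerA.
apply: convex_hull_fin => [u||u].
- by have [H _ _ _] := tP (tag u); apply: mulr_ge0; [apply: a0 | apply: H].
- rewrite (sigE _ (fun i (j : J i) => a i * (tagged (t i)).1 j)) -a1.
  by apply: eq_bigr => i _; rewrite -mulr_sumr; have [_ -> _ _] := tP i; rewrite mulr1.
- by have [_ _ H _] := tP (tag u); apply: H.
Qed.

Lemma convex_hull_segment S x y (t : R) : 0 <= t <= 1 ->
  convex_hull S x -> convex_hull S y -> convex_hull S (t *: x + (1 - t) *: y).
Proof.
move=> /andP[t0 t1] Sx Sy; apply: convex_hull_idem.
rewrite (_ : _ + _ = \sum_(b : bool) (if b then t else 1 - t) *: (if b then x else y)).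
  apply: convex_hull_fin => [[]|| []] //; rewrite ?subr_ge0 //.
  by rewrite big_bool /= addrC subrK.
by rewrite big_bool.
Qed.

Definition nat_row (al : {ffun 'I_k -> nat}) : 'rV[R]_k := \row_i (al i)%:R.

Section Permutations.
Variable lam : seq nat.

Let perms : classical_sets.set 'rV[R]_k :=
  fun x => exists s : 'S_k, x = \row_i (nth 0%N lam (s i))%:R.

(** Permuting coordinates is linear and maps the generating points to generating points. *)
Lemma hull_perms_perm (s : 'S_k) (al : {ffun 'I_k -> nat}) :
  convex_hull perms (nat_row al) -> convex_hull perms (nat_row [ffun i => al (s i)]).
Proof.
move=> [n [a [p [a0 a1 pS E]]]].
exists n, a, (fun l => col_perm s (p l)); split=> // [l|].
  have [s' ->] := pS l; exists (s * s')%g.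
  by apply/rowP => i; rewrite !mxE permM.
apply/rowP => i; rewrite !mxE ffunE.
move/rowP/(_ (s i)): E; rewrite mxE => ->; rewrite !summxE; apply: eq_bigr => l _.
by rewrite !mxE.
Qed.

(* With [d = al i - al j], the transfer is [(1 - 1/d) al + (1/d) al'], where
   [al'] is [al] with its entries [i] and [j] exchanged. *)
Lemma hull_perms_transfer (i j : 'I_k) (al : {ffun 'I_k -> nat}) :
  (al j < al i)%N -> convex_hull perms (nat_row al) ->
  convex_hull perms (nat_row (transfer i j al)).
Proof.
move=> ij alP; have al'P := hull_perms_perm (tperm i j) alP.
pose d : R := (al i)%:R - (al j)%:R.
have d_ge1 : 1 <= d by rewrite lerBrDr addrC natr1 ler_nat.
have d_gt0 : 0 < d := lt_le_trans ltr01 d_ge1.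
have -> : nat_row (transfer i j al) =
    (1 - d^-1) *: nat_row al + (1 - (1 - d^-1)) *: nat_row [ffun l => al (tperm i j l)].
  apply/rowP => l; rewrite !mxE !ffunE subKr.
  have dK : d^-1 * ((al i)%:R - (al j)%:R) = 1 by rewrite mulVf // gt_eqF.
  move: (d^-1) dK => c dK.
  have [->|li] := eqVneq l i.
    rewrite tpermL -subn1 natrB; last exact: leq_ltn_trans ij.
    by rewrite -[1%:R]dK; ring.
  have [->|lj] := eqVneq l j.
    by rewrite tpermR -natr1 -[X in _ + X = _]dK; ring.
  by rewrite tpermD 1?eq_sym // mulrBl mul1r subrK.
apply: convex_hull_segment alP al'P.
by rewrite subr_ge0 gerBl invr_ge0 (ltW d_gt0) andbT invf_le1.
Qed.

End Permutations.
End Hulls.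

(** * Support and Newton polytope of the chromatic polynomial *)

Section Support.
Local Open Scope ring_scope.
Variables (R : realType) (T : finType) (e : rel T) (k : nat).

(** Each coefficient counts colorings, so nothing cancels and it is nonzero as soon as one coloring
    has that weight. *)
Lemma mcoeff_chromatic (m : 'X_{1..k}) : (chromatic_poly R e k)@_m =
  #|[set f : {ffun T -> 'I_k} | proper_coloring e f && ((\sum_v U_(f v))%MM == m)]|%:R.
Proof.
rewrite /chromatic_poly raddf_sum /= -sum1_card natr_sum.
rewrite [RHS](eq_bigl (fun f : {ffun T -> 'I_k} =>
  proper_coloring e f && ((\sum_v U_(f v))%MM == m))) => [|f]; last by rewrite inE.
rewrite big_mkcondr /=; apply: eq_bigr => f _.
by rewrite mprodXE mcoeffX; case: eqP.
Qed.

Lemma supp_chromaticP (x : 'rV[R]_k) : supp (chromatic_poly R e k) x <->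
  exists2 al : {ffun 'I_k -> nat}, vector_realized e al & x = nat_row R al.
Proof.
have weightE (f : T -> 'I_k) i : (\sum_v U_(f v))%MM i = #|[set v | f v == i]|.
  rewrite mnm_sumE -sum1_card big_mkcond [RHS]big_mkcond; apply: eq_bigr => v _ /=.
  by rewrite mnm1E inE; case: eqP.
split=> [[m + ->] | [al [f fP fN] ->]].
  rewrite mcoeff_chromatic pnatr_eq0 -lt0n => /card_gt0P[f].
  rewrite inE => /andP[fP /eqP <-].
  exists [ffun i => (\sum_v U_(f v))%MM i]; last by apply/rowP => i; rewrite !mxE ffunE.
  by exists f => // i; rewrite ffunE weightE.
exists [multinom al i | i < k]; last by apply/rowP => i; rewrite !mxE mnmE.
rewrite mcoeff_chromatic pnatr_eq0 -lt0n; apply/card_gt0P; exists (finfun f).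
rewrite inE; apply/andP; split.
  move/proper_coloringP: fP => fP; apply/proper_coloringP => u v /fP.
  by rewrite !ffunE.
apply/eqP/mnmP => i; rewrite weightE mnmE -fN; apply: eq_card => v.
by rewrite !inE ffunE.
Qed.

Variable lam : seq nat.
Hypothesis lam_realized : realizes e (nth 0%N lam).
Hypothesis lam_dominates : forall f : T -> nat, proper_coloring e f ->
  forall m, (#|[set v | f v < m]| <= \sum_(c < m) nth 0 lam c)%N.
Hypothesis robin_hood_realized : forall N a b,
  realizes e N -> (N b < N a)%N -> realizes e (robin_hood a b N).

Lemma supp_chromatic_int (x : 'rV[R]_k) :
  supp (chromatic_poly R e k) x -> x \is a mxOver Num.int.
Proof.
by move=> /supp_chromaticP[al _ ->]; apply/mxOverP => i j; rewrite mxE intr_nat ?natr_nat.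
Qed.

(** The bounds on subset sums and the value of the total hold at every support point and pass to
    convex combinations; an integer point satisfying them is realized, by [rado_lam]. *)
Lemma Newton_chromatic_int (x : 'rV[R]_k) :
  Newton (chromatic_poly R e k) x -> x \is a mxOver Num.int ->
  supp (chromatic_poly R e k) x.
Proof.
move=> [n [a [p [a0 a1 /(_ _)/supp_chromaticP pS xE]]]] /mxOverP xint.
case: n => [|n] in a p a0 a1 pS xE *.
  by move/eqP: a1; rewrite big_ord0 eq_sym oner_eq0.
have /fin_all_exists[al alP] (l : 'I_n.+1) :
    exists al, vector_realized e al /\ p l = nat_row R al.
  by have [al] := pS l; exists al.
have sumE (A : {set 'I_k}) :
    \sum_(i in A) x 0 i = \sum_l a l * (\sum_(i in A) al l i)%:R.
  rewrite (eq_bigr (fun i => \sum_l a l * (al l i)%:R)) => [|i _].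
    by rewrite exchange_big; apply: eq_bigr => l _; rewrite -mulr_sumr natr_sum.
  rewrite xE summxE; apply: eq_bigr => l _.
  by have [_ ->] := alP l; rewrite !mxE.
(* A coordinate is the sum over a singleton, hence a nonnegative combination of natural numbers;
   being an integer, it is natural. *)
have /fin_all_exists[b bE] (i : 'I_k) : exists m : nat, x 0 i = m%:R.
  apply/natrP; rewrite natrEint xint /=.
  rewrite -(big_set1 (GRing.add (s := R)) i (x 0)).
  by rewrite sumE sumr_ge0 // => l _; rewrite mulr_ge0.
apply/supp_chromaticP; exists [ffun i => b i]; last first.
  by apply/rowP => i; rewrite !mxE ffunE bE.
have [alR _] := alP ord0.
have kT := vector_realized_fits lam_realized lam_dominates alR.
have sum_b (A : {set 'I_k}) : (\sum_(i in A) [ffun i => b i] i)%:R = \sum_(i in A) x 0 i.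
  by rewrite natr_sum; apply: eq_bigr => i _; rewrite ffunE bE.
apply: (rado_lam (lam := lam) _ _ kT) => [i j be|s be|A||].
- exact: vector_realized_transfer.
- exact: vector_realized_perm.
- rewrite -(ler_nat R) sum_b sumE -[leRHS]mul1r -[X in X * _]a1 mulr_suml.
  apply: ler_sum => l' _; apply: ler_wpM2l => //; rewrite ler_nat.
  by apply: (vector_realized_leq lam_dominates); have [] := alP l'.
- have setTE (F : 'I_k -> nat) : (\sum_i F i = \sum_(i in [set: 'I_k]) F i)%N.
    by apply: eq_bigl => i; rewrite inE.
  apply/eqP; rewrite -(eqr_nat R) setTE sum_b sumE -[eqbRHS]mul1r.
  rewrite -[X in X * _]a1 mulr_suml; apply/eqP/eq_bigr => l' _.
  have [/sum_vector_realized <- _] := alP l'.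
  by rewrite setTE.
- exact: lam_vector_realized.
Qed.

Lemma chromatic_SNP : SNP (chromatic_poly R e k).
Proof.
apply/classical_sets.seteqP; split=> x.
  by move=> xS; split; [apply: convex_hull_mem | apply: supp_chromatic_int].
by move=> [xN xint]; apply: Newton_chromatic_int.
Qed.

Lemma Newton_chromatic : Newton (chromatic_poly R e k) = permutahedron R k lam.
Proof.
rewrite /permutahedron; case: (count_lamP lam_realized lam_dominates k) => [kT|kT].
  have lamR := lam_vector_realized lam_realized kT.
  apply/classical_sets.seteqP; split=> x.
    (* By idempotence it suffices to place each support point in the hull of the permutations. *)
    move=> xN; apply: convex_hull_idem; move: x xN; apply: convex_hull_mono => x.
    move=> /supp_chromaticP[al alR ->].
    apply: (rado_lam (lam := lam) (Q := fun al => convex_hull _ (nat_row R al)) _ _ kT).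
    - by move=> i j be; apply: hull_perms_transfer.
    - by move=> s be; apply: hull_perms_perm.
    - by move=> A; apply: (vector_realized_leq lam_dominates).
    - exact: sum_vector_realized alR.
    apply: convex_hull_mem; exists 1%g; apply/rowP => i.
    by rewrite !mxE ffunE perm1.
  apply: convex_hull_mono => y [s ->]; apply/supp_chromaticP.
  exists [ffun i => lam_vector lam k (s i)]; first exact: vector_realized_perm.
  by apply/rowP => i; rewrite !mxE !ffunE.
(* With more than [k] positive entries in [lam] no proper coloring uses only [k] colors, so the
   support is empty and so is its hull. *)
apply/classical_sets.seteqP; split=> x //.
move=> [[|n] [a [p [_ a1 pS _]]]].
  by move/eqP: a1; rewrite big_ord0 eq_sym oner_eq0.
have /supp_chromaticP[al alR _] := pS ord0.
by case: kT; apply: vector_realized_fits alR.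
Qed.

End Support.

Theorem theorem5p8 (R : realType) (disp : Order.disp_t)
    (P : finPOrderType disp) (lam : seq nat) (k : nat)
    (hP : three_plus_one_free P) (hlam : is_lambda_gr P lam)
    (hk : (1 <= k)%N) :
  [/\ SNP (chromatic_poly R (@incomp disp P) k),
      Newton (chromatic_poly R (@incomp disp P) k) = permutahedron R k lam
    & forall f : P -> nat, proper_coloring (@incomp disp P) f -> dominates lam (wt f)].
Proof.
have [lamR lam_dom transferR] := lambda_gr_spec hlam.
split; first exact: chromatic_SNP lamR lam_dom transferR.
  exact: Newton_chromatic lamR lam_dom.
exact: lam_dominates_wt lamR lam_dom.
Qed.
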